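(* Let $q$ be a power of a prime $p$, $K$ the algebraic closure of $\mathbb{F}_q$, and let $m\geq 2$, $r\geq 2$ be integers with $p\nmid m$. Let $\alpha_1,\dots,\alpha_r\in K$ be pairwise distinct, let $\lambda_1,\dots,\lambda_r$ be integers with $1\leq \lambda_i<m$, put $\lambda_0:=\sum_{i=1}^r\lambda_i$, and assume $\gcd(m,\lambda_0)=1$. Let $\mathcal{X}$ be the curve defined by $y^m=\prod_{i=1}^r (x-\alpha_i)^{\lambda_i}$ and let $Q_\infty$ be its only place at infinity. Suppose that $\mathcal{X}$ is defined over $\mathbb{F}_{q^2}$, that $\gcd(m,\lambda_i)=1$ for $i=1,\dots,r$, and that $r<m$. Then the following statements are equivalent: (i) $(\mathcal{X},Q_\infty)$ is an $\mathbb{F}_{q^2}$-maximal Castle curve. (ii) $(\mathcal{X},Q_\infty)$ is a Castle curve and $m=q+1$. (iii) $\mathcal{X}$ is $\mathbb{F}_{q^2}$-maximal, $H(Q_\infty)$ is symmetric, and $m=q+1$. (iv) $\mathcal{X}$ is $\mathbb{F}_{q^2}$-maximal, $\#\mathcal{X}(\mathbb{F}_{q^2})=q^2m_{H(Q_\infty)}+1$, and $m=q+1$. (v) $\mathcal{X}$ is $\mathbb{F}_{q^2}$-maximal, $\lambda_1=\cdots=\lambda_r$, and $m=q+1$.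
   Context: $\mathcal{X}$ denotes the nonsingular projective absolutely irreducible curve with function field $K(\mathcal{X})=K(x,y)$ over $K$ given by the affine equation; $Q_\infty$ is the unique place lying over the pole of $x$. That $\mathcal{X}$ is defined over $\mathbb{F}_{q^2}$ means $\prod_{i=1}^r (x-\alpha_i)^{\lambda_i}\in\mathbb{F}_{q^2}[x]$ (the place $Q_\infty$ is then $\mathbb{F}_{q^2}$-rational). $\#\mathcal{X}(\mathbb{F}_{q^2})$ is the number of $\mathbb{F}_{q^2}$-rational places (places of degree one) of $\mathcal{X}$, and $g(\mathcal{X})$ is the genus. $\mathcal{X}$ is $\mathbb{F}_{q^2}$-maximal if $\#\mathcal{X}(\mathbb{F}_{q^2})=q^2+1+2g(\mathcal{X})q$. The Weierstrass semigroup at a place $Q$ is $H(Q):=\{s\in\mathbb{N}_0 : (z)_\infty=sQ \text{ for some } z\in K(\mathcal{X})\}$, where $(z)_\infty$ is the pole divisor; its multiplicity $m_{H(Q)}$ is its smallest nonzero element; its Frobenius number $F_{H(Q)}$ is the largest element of $\mathbb{N}\setminus H(Q)$; it is symmetric if $F_{H(Q)}=2g(\mathcal{X})-1$. The pair $(\mathcal{X},Q_\infty)$ is a Castle curve (over $\mathbb{F}_{q^2}$) if $H(Q_\infty)$ is symmetric and $\#\mathcal{X}(\mathbb{F}_{q^2})=q^2m_{H(Q_\infty)}+1$; it is an $\mathbb{F}_{q^2}$-maximal Castle curve if moreover $\mathcal{X}$ is $\mathbb{F}_{q^2}$-maximal. *)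

(* Defs.v *)
From HB Require Import structures.
From mathcomp Require Import all_boot all_order all_algebra.
From mathcomp Require Import all_classical.

Set Implicit Arguments.
Unset Strict Implicit.
Unset Printing Implicit Defensive.

Import Order.TTheory GRing.Theory Num.Theory.
Local Open Scope classical_set_scope.
Local Open Scope card_scope.
Local Open Scope ring_scope.

(** Function fields of one variable [E] over a constant field [k], embedded by
    [i : k -> E], following Stichtenoth, "Algebraic Function Fields and Codes",
    Chapter 1.  A place is represented by its valuation ring, a [set E]; the
    values of functions of places, such as divisors, are only relevant on
    arguments satisfying [place].  Functions defined with [xget] select the
    unique element with the stated property; the default value is never used
    for a function field, except where noted. *)

Section FunctionField.
Variables (k E : fieldType) (i : {rmorphism k -> E}).

(** [E = k(x, y)] *)
Definition generated2 (x y : E) : Prop :=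
  forall z : E, exists N D : {poly {poly k}},
    (map_poly (map_poly i) D).[x%:P].[y] != 0 /\
    z = (map_poly (map_poly i) N).[x%:P].[y] /
        (map_poly (map_poly i) D).[x%:P].[y].

Definition place (P : set E) : Prop :=
  [/\ range i `<` P, P `<` setT,
      forall z w : E, P z -> P w -> P (z - w) /\ P (z * w)
    & forall z : E, P z \/ P z^-1].

Definition place_units (P : set E) : set E :=
  [set z | [/\ P z, z != 0 & P z^-1]].

Definition place_ideal (P : set E) : set E := P `\` place_units P.

Definition prime_element (P : set E) (t : E) : Prop :=
  place_ideal P = [set t * z | z in P].

(** The normalized discrete valuation, meaningful for [z != 0]. *)
Definition valuation (P : set E) (z : E) : int :=
  xget 0 [set n : int | exists t u : E,
    [/\ prime_element P t, place_units P u & z = t ^ n * u]].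

(** The dimension over [k] of [V / W], for [k]-subspaces [W] of [V] of [E]
    (0 if it is infinite). *)
Definition quotient_dim (V W : set E) : nat :=
  xget 0%N [set n : nat | exists b : 'I_n -> E,
    (forall j, V (b j)) /\
    forall z, V z ->
      exists! c : 'rV[k]_n, W (z - \sum_(j < n) i (c 0 j) * b j)].

Definition place_degree (P : set E) : nat := quotient_dim P (place_ideal P).

Definition rational_places : set (set E) :=
  [set P | place P /\ place_degree P = 1%N].

Definition is_divisor (A : set E -> int) : Prop :=
  finite_set [set P | place P /\ A P != 0].

Definition divisor_degree (A : set E -> int) : int :=
  \sum_(P \in [set P | place P]) A P * (place_degree P)%:Z.

Definition riemann_roch_space (A : set E -> int) : set E :=
  [set z | z = 0 \/ forall P, place P -> - A P <= valuation P z].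

Definition riemann_roch_dim (A : set E -> int) : nat :=
  quotient_dim (riemann_roch_space A) [set 0].

(** The maximum of [deg A - l(A) + 1] over all divisors [A]. *)
Definition genus : nat :=
  xget 0%N [set g : nat |
    (exists A, is_divisor A /\
       divisor_degree A - (riemann_roch_dim A)%:Z + 1 = g%:Z) /\
    forall A, is_divisor A ->
       divisor_degree A - (riemann_roch_dim A)%:Z + 1 <= g%:Z].

(** Meaningful for [z != 0]. *)
Definition pole_divisor (z : E) (P : set E) : int :=
  Num.max 0 (- valuation P z).

Definition weierstrass_semigroup (Q : set E) : set nat :=
  [set s | exists z : E, z != 0 /\
     forall P, place P -> pole_divisor z P = if P == Q then s%:Z else 0].

End FunctionField.

Definition multiplicity (H : set nat) : nat :=
  xget 0%N [set s | [/\ H s, s != 0%N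
    & forall s', H s' -> s' != 0%N -> (s <= s')%N]].

(** Equal to -1, by the usual convention, if [H] is the set of all naturals. *)
Definition frobenius_number (H : set nat) : int :=
  xget (-1) [set f : int | exists n : nat,
    [/\ f = n%:Z, ~ H n & forall n', ~ H n' -> (n' <= n)%N]].

Definition symmetric_at (k E : fieldType) (i : {rmorphism k -> E})
    (Q : set E) : Prop :=
  frobenius_number (weierstrass_semigroup i Q) = (genus i)%:Z *+ 2 - 1.

(** A curve over the finite field [k0] with [N] elements is given by its
    function field [E0] over [k0] and by its function field [E] over an
    algebraic closure [K] of [k0]: the rational places are those of degree one
    of [E0 / k0], the genus and the Weierstrass semigroups are those
    of [E / K]. *)

Section Curve.
Variables (k0 E0 K E : fieldType).
Variables (i0 : {rmorphism k0 -> E0}) (i : {rmorphism K -> E}).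

(** Number of rational places equal to [q ^ 2 + 1 + 2 g q]. *)
Definition maximal_curve (q : nat) : Prop :=
  rational_places i0 #= `I_(q ^ 2 + 1 + 2 * genus i * q)%N.

(** Number of rational places equal to [N * m + 1], where [m] is the
    multiplicity of the Weierstrass semigroup at [Q]. *)
Definition castle_count (N : nat) (Q : set E) : Prop :=
  rational_places i0 #=
    `I_(N * multiplicity (weierstrass_semigroup i Q) + 1)%N.

Definition castle_curve (N : nat) (Q : set E) : Prop :=
  symmetric_at i Q /\ castle_count N Q.

End Curve.

(* Main.v *)
(** The places of [E] other than [Q] are the points [(a, b)] with
    [b ^ m = f(a)], where [f = prod_l (x - alpha_l) ^ lambda_l]; those with
    [b = 0], and [Q], are totally ramified over [K(x)].  Comparing orders there,
    the functions regular outside [Q] form the free [K[x]]-module on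
    [y ^ j / prod_l (x - alpha_l) ^ floor (j lambda_l / m)], [0 <= j < m], whose
    pole orders [b_j = sum_l (j lambda_l mod m)] at [Q] are distinct modulo [m].
    So [H(Q)] consists of the [b_j + d m]; it has [(m - 1)(r - 1) / 2] gaps, and
    this is the genus by Riemann's inequality.  For [0 < j], [b_j] lies between
    [r] and [r (m - 1)]; [H(Q)] is symmetric iff the upper bound is
    attained, and has multiplicity [r] iff the lower one is, and each of these
    happens iff all the [lambda_l] are equal.  What remains is arithmetic with
    [q], [m] and [r]; no rational place has to be counted. *)

Require Import Defs.
From HB Require Import structures.
From mathcomp Require Import all_boot all_order all_algebra.
From mathcomp Require Import all_classical.
From mathcomp Require Import ring zify.
From mathcomp Require finfield.

Set Implicit Arguments.
Unset Strict Implicit.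
Unset Printing Implicit Defensive.

Import Order.TTheory GRing.Theory Num.Theory.
Local Open Scope classical_set_scope.
Local Open Scope ring_scope.

(** * Valuation rings *)

(** Neither the irreducibility of [Y^m - f] nor the existence of a place over a point of the curve
    is given; the only place at hand is [Q]. Since [m] is prime to the sum of the [lambda l], the
    powers of [y] have orders at [Q] that are distinct modulo [m]. This makes them independent over
    [K(x)] and so determines all relations between [x] and [y]; Chevalley's extension theorem then
    yields a place over each point. Orders at a place are computed from its centre alone, which
    shows that the place is discrete and unique. As the genus is a maximum over all divisors, an
    upper bound is needed for each of them: the functions [x - i a], whose divisors have degree zero
    by direct count, move the positive part of a divisor to [Q]. The result lies below a multiple of
    [Q], whose dimension counts elements of the semigroup. *)

Section Place.
Variables (k E : fieldType) (i : {rmorphism k -> E}) (P : set E).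
Hypothesis P_place : place i P.

Lemma place_const c : P (i c).
Proof. by case: P_place => -[sP _] _ _ _; apply: sP; exists c. Qed.

Lemma placeB z w : P z -> P w -> P (z - w).
Proof. by case: P_place => _ _ H _ Pz Pw; case: (H z w Pz Pw). Qed.

Lemma placeM z w : P z -> P w -> P (z * w).
Proof. by case: P_place => _ _ H _ Pz Pw; case: (H z w Pz Pw). Qed.

Lemma place0 : P 0. Proof. by rewrite -(rmorph0 i); apply: place_const. Qed.

Lemma place1 : P 1. Proof. by rewrite -(rmorph1 i); apply: place_const. Qed.

Lemma placeD z w : P z -> P w -> P (z + w).
Proof.
move=> Pz Pw; rewrite -[w]opprK; apply: placeB => //.
by rewrite -sub0r; apply: placeB => //; apply: place0.
Qed.

Lemma placeX z n : P z -> P (z ^+ n).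
Proof.
by move=> Pz; elim: n => [|n IH]; [apply: place1 | rewrite exprS;
  apply: placeM].
Qed.

Lemma place_sum (I : Type) (s : seq I) (p : pred I) (F : I -> E) :
  (forall l, p l -> P (F l)) -> P (\sum_(l <- s | p l) F l).
Proof. by move=> H; apply: (big_ind P) => //;
  [apply: place0 | apply: placeD]. Qed.

Lemma place_prod (I : Type) (s : seq I) (p : pred I) (F : I -> E) :
  (forall l, p l -> P (F l)) -> P (\prod_(l <- s | p l) F l).
Proof. by move=> H; apply: (big_ind P) => //;
  [apply: place1 | apply: placeM]. Qed.

Lemma place_total z : P z \/ P z^-1.
Proof. by case: P_place. Qed.

Lemma place_idealE z : place_ideal P z <-> z = 0 \/ ~ P z^-1.
Proof.
split=> [[Pz nU]|[->|nPV]].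
- have [->|z0] := eqVneq z 0; first by left.
  by right=> PV; apply: nU; split.
- by split; [exact: place0 | case; rewrite eqxx].
- split; last by case.
  by case: (place_total z).
Qed.

Lemma place_ideal_sub z : place_ideal P z -> P z. Proof. by case. Qed.

Lemma place_ideal0 : place_ideal P 0. Proof. by apply/place_idealE; left. Qed.

Lemma place_ideal1 : ~ place_ideal P 1.
Proof.
move/place_idealE => [/eqP|]; first by rewrite oner_eq0.
by rewrite invr1; apply; apply: place1.
Qed.

Lemma place_notin z : ~ P z -> z != 0 /\ place_ideal P z^-1.
Proof.
move=> nP; split; first by apply: contra_notN nP => /eqP->; apply: place0.
by apply/place_idealE; right; rewrite invrK.
Qed.

Lemma place_idealM z w : P z -> place_ideal P w -> place_ideal P (z * w).
Proof.
move=> Pz /place_idealE[->|nw]; first by rewrite mulr0; apply: place_ideal0.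
have [->|z0] := eqVneq z 0; first by rewrite mul0r; apply: place_ideal0.
apply/place_idealE; right => H; apply: nw.
have -> : w^-1 = z * (z * w)^-1 by rewrite invfM mulVKf.
exact: placeM.
Qed.

(** One of [z / w] and [w / z] lies in [P], so the sum is a multiple of one of its terms by an
    element of [P]. *)
Lemma place_idealD z w :
  place_ideal P z -> place_ideal P w -> place_ideal P (z + w).
Proof.
have gen u v : P (u / v) -> place_ideal P u -> place_ideal P v ->
    place_ideal P (u + v).
  move=> Puv mu mv; have [->|v0] := eqVneq v 0; first by rewrite addr0.
  have -> : u + v = (u / v + 1) * v by rewrite mulrDl divfK // mul1r.
  apply: place_idealM => //.
  by apply: placeD => //; apply: place1.
move=> mz mw; case: (place_total (z / w)) => H; first exact: gen.
by rewrite addrC; apply: gen => //; rewrite -invf_div.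
Qed.

Lemma place_idealN z : place_ideal P z -> place_ideal P (- z).
Proof.
rewrite -mulN1r; apply: place_idealM; rewrite -(rmorphN1 i).
exact: place_const.
Qed.

Lemma place_idealB z w :
  place_ideal P z -> place_ideal P w -> place_ideal P (z - w).
Proof. by move=> mz mw; apply: place_idealD => //; apply: place_idealN. Qed.

Lemma place_ideal_sum (I : Type) (s : seq I) (p : pred I) (F : I -> E) :
  (forall l, p l -> place_ideal P (F l)) ->
  place_ideal P (\sum_(l <- s | p l) F l).
Proof.
by move=> H; apply: (big_ind (place_ideal P)) => //;
  [apply: place_ideal0 | apply: place_idealD].
Qed.

Lemma place_ideal_const c : place_ideal P (i c) -> c = 0.
Proof.
move/place_idealE => [/eqP|]; first by rewrite fmorph_eq0 => /eqP.
by rewrite -fmorphV => /(_ (place_const _)).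
Qed.

Lemma place_ideal_inv z : P z -> ~ place_ideal P z -> z != 0 /\ P z^-1.
Proof.
move=> Pz nm; split; first by apply: contra_notN nm => /eqP->;
  apply: place_ideal0.
by apply: contrapT => H; apply: nm; apply/place_idealE; right.
Qed.

Lemma place_ideal_prime z w :
  P z -> place_ideal P (z * w) -> place_ideal P z \/ place_ideal P w.
Proof.
move=> Pz mzw; have [mz|nmz] := pselect (place_ideal P z); [by left|right].
have [z0 PV] := place_ideal_inv Pz nmz.
by rewrite -[w](mulKf z0); apply: place_idealM.
Qed.

(** Valuation rings are integrally closed: if [z] is not in [P], then [z^-1] is a nonunit, and
    [1 = z ^+ n * z^-1 ^+ n] would be one too. *)
Lemma place_root n z : (0 < n)%N -> P (z ^+ n) -> P z.
Proof.
move=> n0 Pz; apply: contrapT => /place_notin[z0 mV].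
apply: place_ideal1; rewrite -(mulfV (expf_neq0 n z0)).
apply: place_idealM => //; rewrite -exprVn -(prednK n0) exprSr.
by apply: place_idealM => //; apply: placeX; apply: place_ideal_sub.
Qed.

Lemma place_ideal_exp n z :
  (0 < n)%N -> place_ideal P z -> place_ideal P (z ^+ n).
Proof.
move=> n0 mz; rewrite -(prednK n0) exprSr; apply: place_idealM => //.
by apply: placeX; apply: place_ideal_sub.
Qed.

Lemma place_ideal_root n z :
  (0 < n)%N -> place_ideal P (z ^+ n) -> place_ideal P z.
Proof.
move=> n0 mz; have Pz : P z by apply: (place_root n0); apply: place_ideal_sub.
apply: contrapT => /(place_ideal_inv Pz)[z0 PV].
apply: place_ideal1; rewrite -(mulVf (expf_neq0 n z0)).
by apply: place_idealM => //; rewrite -exprVn; apply: placeX.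
Qed.

Lemma place_ideal_prod (I : Type) (s : seq I) (F : I -> E) :
  (forall l, P (F l)) ->
  place_ideal P (\prod_(l <- s) F l) -> exists l, place_ideal P (F l).
Proof.
move=> PF; elim: s => [|l s IH]; first by rewrite big_nil => /place_ideal1.
by rewrite big_cons => /(place_ideal_prime (PF l))[?|/IH//]; exists l.
Qed.

(** Residues are required to lie in the constant field, so that [place_ord]
    controls the valuation and the residue field at the same time. *)
Definition nonzero_residue (z : E) : Prop :=
  exists2 c, c != 0 & place_ideal P (z - i c).

Lemma nonzero_residue_place z : nonzero_residue z -> P z.
Proof.
case=> c _ m; rewrite -[z](subrK (i c)); apply: placeD; last exact: place_const.
exact: place_ideal_sub.
Qed.

Lemma nonzero_residue_ideal z : nonzero_residue z -> ~ place_ideal P z.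
Proof.
move=> [c c0 m] mz; move/eqP: c0; apply; apply: place_ideal_const.
by rewrite -[i c](subKr z); apply: place_idealB.
Qed.

Lemma residueM z w c d : place_ideal P (z - i c) -> place_ideal P (w - i d) ->
  place_ideal P (z * w - i (c * d)).
Proof.
move=> mz mw; have -> : z * w - i (c * d) = z * (w - i d) + i d * (z - i c).
  by rewrite rmorphM; ring.
apply: place_idealD; apply: place_idealM => //; last exact: place_const.
rewrite -[z](subrK (i c)); apply: placeD; last exact: place_const.
exact: place_ideal_sub.
Qed.

Lemma residueV z c : c != 0 -> place_ideal P (z - i c) ->
  z != 0 /\ place_ideal P (z^-1 - i c^-1).
Proof.
move=> c0 mz; have nz : nonzero_residue z by exists c.
have [z0 PV] := place_ideal_inv (nonzero_residue_place nz) (nonzero_residue_ideal nz).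
have ic0 : i c != 0 by rewrite fmorph_eq0.
split=> //; have -> : z^-1 - i c^-1 = - (z^-1 * i c^-1 * (z - i c)).
  by rewrite fmorphV; field; rewrite ic0 z0.
apply: place_idealN; apply: place_idealM => //; apply: placeM => //.
exact: place_const.
Qed.

Lemma nonzero_residueV z : nonzero_residue z -> z != 0 /\ nonzero_residue z^-1.
Proof.
move=> [c c0 /(residueV c0)[z0 mV]]; split=> //.
by exists c^-1; rewrite ?invr_eq0.
Qed.

Lemma nonzero_residueM z w :
  nonzero_residue z -> nonzero_residue w -> nonzero_residue (z * w).
Proof.
move=> [c c0 mz] [d d0 mw]; exists (c * d); first by rewrite mulf_neq0.
exact: residueM.
Qed.

Lemma nonzero_residueD z w :
  nonzero_residue z -> place_ideal P w -> nonzero_residue (z + w).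
Proof. by move=> [c c0 m] mw; exists c => //; rewrite addrAC;
  apply: place_idealD. Qed.

Lemma nonzero_residue_const c : c != 0 -> nonzero_residue (i c).
Proof. by move=> c0; exists c => //; rewrite subrr; apply: place_ideal0. Qed.

Lemma nonzero_residueX z (n : int) :
  nonzero_residue z -> nonzero_residue (z ^ n).
Proof.
move=> rz; have rzn l : nonzero_residue (z ^+ l).
  elim: l => [|l IH]; last by rewrite exprS; apply: nonzero_residueM.
  by rewrite expr0 -(rmorph1 i); apply: nonzero_residue_const; apply: oner_neq0.
case: n => l; first exact: rzn.
by case: (nonzero_residueV (rzn l.+1)).
Qed.

(** * Orders with respect to an element of the maximal ideal *)

Variable t : E.

(** A relation rather than a function: it makes sense before [t] is known to be a uniformizer, and
    it is also used with a [t] that is none, such as [x^-1] at [Q]. *)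
Definition place_ord (z : E) (n : int) :
  Prop := nonzero_residue (z * t ^ (- n)).

Hypotheses (t_ideal : place_ideal P t) (t_neq0 : t != 0).

Lemma place_ord_neq0 z n : place_ord z n -> z != 0.
Proof.
by case/nonzero_residueV => + _; apply: contra_neq => ->; rewrite mul0r.
Qed.

Lemma place_ord0P z : place_ord z 0 <-> nonzero_residue z.
Proof. by rewrite /place_ord oppr0 expr0z mulr1. Qed.

Lemma place_ord_const c : c != 0 -> place_ord (i c) 0.
Proof. by move=> c0; apply/place_ord0P; apply: nonzero_residue_const. Qed.

Lemma place_ord1 : place_ord 1 0.
Proof. by rewrite -(rmorph1 i); apply: place_ord_const; apply: oner_neq0. Qed.

Lemma place_ordM z w n l :
  place_ord z n -> place_ord w l -> place_ord (z * w) (n + l).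
Proof.
move=> oz ow; rewrite /place_ord opprD expfzDr // mulrACA.
exact: nonzero_residueM.
Qed.

Lemma place_ordV z n : place_ord z n -> place_ord z^-1 (- n).
Proof. by case/nonzero_residueV => _; rewrite invfM invr_expz. Qed.

Lemma place_ord_uniformizer : place_ord t 1.
Proof.
rewrite /place_ord -{1}[t]expr1z -expfzDr // subrr expr0z -(rmorph1 i).
exact: nonzero_residue_const (oner_neq0 _).
Qed.

Lemma place_ordXn z n l : place_ord z n -> place_ord (z ^+ l) (n * l%:Z).
Proof.
move=> oz; elim: l => [|l IH]; first by rewrite expr0 mulr0; apply: place_ord1.
by rewrite exprS intS mulrDr mulr1; apply: place_ordM.
Qed.

Lemma place_ordXz z n (l : int) : place_ord z n -> place_ord (z ^ l) (n * l).
Proof.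
case: l => l oz; first exact: place_ordXn.
by rewrite NegzE mulrN; apply: place_ordV; apply: place_ordXn.
Qed.

Lemma place_ord_uniformizerX (n : int) : place_ord (t ^ n) n.
Proof. by have := place_ordXz n place_ord_uniformizer; rewrite mul1r. Qed.

Lemma place_ord_ideal z n : place_ord z n -> 0 < n -> place_ideal P z.
Proof.
case: n => [[|n]|] // oz _.
rewrite -[z](mulfK (expf_neq0 n.+1 t_neq0)) mulrAC.
apply: place_idealM; last exact: place_ideal_exp.
exact: nonzero_residue_place.
Qed.

Lemma place_ord_ge0 z n : place_ord z n -> (P z <-> 0 <= n).
Proof.
move=> oz; split=> [Pz|].
  rewrite leNgt; apply/negP => n0.
  have /place_ord_ideal mV : place_ord z^-1 (- n) by exact: place_ordV.
  apply: place_ideal1; rewrite -(mulfV (place_ord_neq0 oz)).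
  by apply: place_idealM => //; apply: mV; rewrite oppr_gt0.
rewrite le_eqVlt => /orP[/eqP n0|n0].
  by apply: nonzero_residue_place; apply/place_ord0P; rewrite n0.
by apply: place_ideal_sub; apply: place_ord_ideal n0.
Qed.

Lemma place_ord_gt0 z n : place_ord z n -> (place_ideal P z <-> 0 < n).
Proof.
move=> oz; split=> [mz|]; last exact: place_ord_ideal.
have /(place_ord_ge0 oz) : P z by exact: place_ideal_sub.
rewrite le_eqVlt => /orP[/eqP n0|//].
by move: oz; rewrite -n0 => /place_ord0P/nonzero_residue_ideal.
Qed.

Lemma place_ord_uniq z n l : place_ord z n -> place_ord z l -> n = l.
Proof.
move=> on ol; have o1 : place_ord 1 (n - l).
  by rewrite -(mulfV (place_ord_neq0 on)); apply: place_ordM => //;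
    apply: place_ordV.
have /(place_ord_gt0 o1) nlt := place_ideal1.
have /(place_ord_ge0 o1) := place1.
by rewrite le_eqVlt => /orP[/eqP/esym/eqP|//]; rewrite subr_eq0 => /eqP.
Qed.

Lemma place_ord_shift z n l : place_ord z n -> place_ord (z * t ^ l) (n + l).
Proof. by move=> oz; apply: place_ordM => //;
  apply: place_ord_uniformizerX. Qed.

Lemma place_ordD z w n :
  place_ord z n -> place_ideal P (w * t ^ (- n)) -> place_ord (z + w) n.
Proof. by move=> oz mw; rewrite /place_ord mulrDl; apply: nonzero_residueD. Qed.

(** A strict minimum among the orders dominates the sum. Through [place_ord_neq0] the sum is then
    nonzero, so this also yields linear independence. *)
Lemma place_ord_sum (I : finType) (F : I -> E) (n : I -> int) :
  (forall l, F l != 0 -> place_ord (F l) (n l)) ->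
  (forall l l', F l != 0 -> F l' != 0 -> n l = n l' -> l = l') ->
  (exists l, F l != 0) ->
  exists l, [/\ F l != 0, place_ord (\sum_l F l) (n l)
              & forall l', F l' != 0 -> n l <= n l'].
Proof.
move=> oF inj [l0 Fl0].
case: (@arg_minP _ _ _ l0 (fun l => F l != 0) n Fl0) => l Fl lmin.
exists l; split=> //; rewrite (bigD1 l) //=; apply: place_ordD; first exact: oF.
rewrite mulr_suml; apply: place_ideal_sum => l' l'l.
have [->|Fl'] := eqVneq (F l') 0; first by rewrite mul0r; apply: place_ideal0.
apply: (place_ord_ideal (place_ord_shift _ (oF _ Fl'))).
rewrite subr_gt0 lt_neqAle lmin // andbT.
by apply: contra_neq l'l => /inj ->.
Qed.

(** This says at once that [P] is discrete, that [t] is a local parameter and, by the form of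
    [nonzero_residue], that the residue field is [k]. *)
Definition uniformizer : Prop := forall z, z != 0 -> exists n, place_ord z n.

Hypothesis t_unif : uniformizer.

Lemma uniformizer_prime : prime_element P t.
Proof.
apply/seteqP; split=> [z mz|_ [z Pz <-]]; last by rewrite mulrC;
  apply: place_idealM.
have [->|z0] := eqVneq z 0; first by exists 0; [exact: place0 | rewrite mulr0].
have [n oz] := t_unif z0; exists (z / t); last by rewrite mulrC divfK.
have /place_ord_ge0 H := place_ord_shift (-1) oz; rewrite exprN1 in H; apply/H.
by move/(place_ord_gt0 oz): mz; lia.
Qed.

Lemma nonzero_residue_units z : nonzero_residue z <-> place_units P z.
Proof.
split=> [rz|[Pz z0 PV]].
  have [z0 rV] := nonzero_residueV rz.
  by split=> //; exact: nonzero_residue_place.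
have [n oz] := t_unif z0; apply/place_ord0P.
suff <- : n = 0 by [].
apply/eqP; rewrite eq_le -oppr_ge0; apply/andP; split.
  exact/(place_ord_ge0 (place_ordV oz)).
exact/(place_ord_ge0 oz).
Qed.

Lemma prime_element_ord s : prime_element P s -> place_ord s 1.
Proof.
move=> sP; have [z Pz tz] : [set s * z | z in P] t by rewrite -sP.
have [w Pw sw] : [set t * z | z in P] s.
  by rewrite -uniformizer_prime sP; exists 1; [exact: place1 | rewrite mulr1].
have s0 : s != 0 by apply: contra_neq t_neq0 => s0; rewrite -tz s0 mul0r.
suff : nonzero_residue w.
  by rewrite -sw mulrC => /place_ord0P /(place_ord_shift 1); rewrite add0r.
apply/nonzero_residue_units; split=> //.
  by apply: contra_neq s0 => w0; rewrite -sw w0 mulr0.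
have zw : z * w = 1 by apply: (mulfI t_neq0); rewrite mulrCA sw mulrC tz mulr1.
suff -> : w^-1 = z by [].
rewrite -[w^-1]mul1r -zw mulfK //.
by apply: contra_neq s0 => w0; rewrite -sw w0 mulr0.
Qed.

(** [valuation] ranges over all prime elements; each of them has order 1 with respect to [t], so
    every admissible exponent is [n]. *)
Lemma valuationE z n : place_ord z n -> valuation P z = n.
Proof.
move=> oz; apply: xget_unique => [|l [s [u [sP uU zE]]]].
  exists t, (z * t ^ (- n)); split; first exact: uniformizer_prime.
    exact/nonzero_residue_units.
  by rewrite mulrCA -expfzDr // subrr expr0z mulr1.
have /place_ord0P ou : nonzero_residue u by apply/nonzero_residue_units.
have := place_ordM (place_ordXz l (prime_element_ord sP)) ou.
by rewrite -zE mul1r addr0 => /place_ord_uniq; apply.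
Qed.

End Place.

(** * Dimensions of quotients *)

Section Dimension.
Variables (k E : fieldType) (i : {rmorphism k -> E}).
Implicit Types V W U : set E.

Definition subspace W : Prop :=
  W 0 /\ forall c z w, W z -> W w -> W (z + i c * w).

Definition quotient_basis V W n (b : 'I_n -> E) : Prop :=
  (forall j, V (b j)) /\
  forall z, V z -> exists! c : 'rV[k]_n, W (z - \sum_(j < n) i (c 0 j) * b j).

Lemma subspace_sum W n (b : 'I_n -> E) (c : 'I_n -> k) :
  subspace W -> (forall j, W (b j)) -> W (\sum_j i (c j) * b j).
Proof.
move=> [W0 WD] Wb; elim/big_ind: _ => // [z w Wz Ww|j _].
  by rewrite -[w]mul1r -(rmorph1 i); apply: WD.
by rewrite -[_ * _]add0r; apply: WD.
Qed.

Lemma subspaceD W z w : subspace W -> W z -> W w -> W (z + w).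
Proof. by move=> [_ WD] Wz Ww; rewrite -[w]mul1r -(rmorph1 i); apply: WD. Qed.

Lemma subspaceN W z : subspace W -> W z -> W (- z).
Proof.
by move=> [W0 WD] Wz; rewrite -[- z]add0r -mulN1r -(rmorphN1 i); apply: WD.
Qed.

(** Expressing each family in the other modulo [W] gives two matrices, whose product is the identity
    by uniqueness of coordinates; this forces [n <= n']. *)
Lemma quotient_basis_le V W n n' (b : 'I_n -> E) (b' : 'I_n' -> E) :
  subspace W -> quotient_basis V W b -> quotient_basis V W b' -> (n <= n')%N.
Proof.
move=> sW [Vb bP] [Vb' bP'].
have /choice[C CP] j : exists c : 'rV[k]_n', W (b j - \sum_l i (c 0 l) * b' l).
  by have [c []] := bP' _ (Vb j); exists c.
have /choice[C' CP'] l : exists c : 'rV[k]_n, W (b' l - \sum_j i (c 0 j) * b j).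
  by have [c []] := bP _ (Vb' l); exists c.
apply: (@mulmx1_min k n n' (\matrix_j C j) (\matrix_l C' l)).
apply/row_matrixP => j; rewrite row_mul rowK row1.
have [c [_ cu]] := bP _ (Vb j).
transitivity c; [apply/esym/cu | apply/cu]; last first.
  rewrite (bigD1 j) //= big1 => [|l lj].
    by rewrite mxE !eqxx rmorph1 mul1r addr0 subrr; case: sW.
  by rewrite mxE eqxx (negbTE lj) rmorph0 mul0r.
have -> : b j - \sum_l i ((C j *m \matrix_l C' l) 0 l) * b l =
    (b j - \sum_l i (C j 0 l) * b' l) +
    \sum_l i (C j 0 l) * (b' l - \sum_l' i (C' l 0 l') * b l').
  rewrite (eq_bigr _ (fun l _ => mulrBr _ _ _)) sumrB addrA subrK;
    congr (_ - _).
  under [RHS]eq_bigr do rewrite mulr_sumr.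
  rewrite exchange_big /=; apply: eq_bigr => l _;
    rewrite mxE rmorph_sum mulr_suml.
  by apply: eq_bigr => l' _; rewrite mxE rmorphM mulrA.
by apply: subspaceD => //; apply: subspace_sum.
Qed.

Lemma quotient_dimE V W n (b : 'I_n -> E) :
  subspace W -> quotient_basis V W b -> quotient_dim i V W = n.
Proof.
move=> sW bP; apply: xget_unique; first by exists b.
move=> n' [b' bP']; apply/eqP; rewrite eqn_leq.
by rewrite (quotient_basis_le sW bP' bP) (quotient_basis_le sW bP bP').
Qed.

Definition has_dim V n : Prop := exists b :
  'I_n -> E, quotient_basis V [set 0] b.

Lemma has_dimE V n : has_dim V n -> quotient_dim i V [set 0] = n.
Proof.
case=> b; apply: quotient_dimE; split=> // c z w /= -> ->.
by rewrite mulr0 addr0.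
Qed.

Lemma has_dim_uniq V n n' : has_dim V n -> has_dim V n' -> n = n'.
Proof. by move=> /has_dimE <- /has_dimE <-. Qed.

Lemma has_dim0 : has_dim [set 0] 0.
Proof.
exists (fun=> 0); split=> [[]//|z /= ->]; exists 0; split=> [|c _].
  by rewrite big_ord0 subrr.
by apply/rowP => -[].
Qed.

Lemma has_dimS U V n b :
  subspace U -> has_dim U n -> V b -> ~ U b -> subspace V -> U `<=` V ->
  (forall z, V z -> exists c, U (z - i c * b)) -> has_dim V n.+1.
Proof.
move=> sU [a [Ua aP]] Vb nUb sV UV VU.
exists (fun j => if unlift ord0 j is Some l then a l else b); split.
  by move=> j; case: unliftP => [l _|_ //]; apply: UV.
move=> z Vz; have [c Uc] := VU z Vz.
have [d [dP du]] := aP _ Uc.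
have sumE (c' : 'rV[k]_n.+1) :
    \sum_j i (c' 0 j) * (if unlift ord0 j is Some l then a l else b) =
    i (c' 0 ord0) * b + \sum_l i (c' 0 (lift ord0 l)) * a l.
  rewrite big_ord_recl unlift_none; congr (_ + _).
  by apply: eq_bigr => l _; rewrite liftK.
exists (\row_j if unlift ord0 j is Some l then d 0 l else c); split.
  rewrite sumE mxE unlift_none opprD addrA.
  by under eq_bigr do rewrite mxE liftK; exact: dP.
move=> c'; rewrite sumE opprD addrA => cP'.
(* If the coefficients of [b] differed, subtracting the two expansions of [z] would put a nonzero
   multiple of [b] into [U]. *)
have cE : c = c' 0 ord0.
  apply: contrapT => cc'; apply: nUb.
  have Ud : U (i (c - c' 0 ord0) * b).
    have -> : i (c - c' 0 ord0) * b =
      (z - i (c' 0 ord0) * b) + (- (z - i c * b)) by rewrite rmorphB; ring.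
    apply: subspaceD => //; last exact: subspaceN.
    move/eqP: cP'; rewrite subr_eq0 => /eqP ->; apply: subspace_sum => //.
  have [U0 UD] := sU; have := UD (c - c' 0 ord0)^-1 _ _ U0 Ud.
  rewrite fmorphV add0r mulKf // fmorph_eq0 subr_eq0; exact/eqP.
have dE : d = \row_l c' 0 (lift ord0 l).
  apply: du; rewrite /= cE; under eq_bigr do rewrite mxE; exact: cP'.
apply/rowP => j; rewrite mxE; case: unliftP => [l ->|->//].
by rewrite dE mxE.
Qed.

End Dimension.

(** * Degree of a place whose residues are constants *)

Section Degree.
Variables (k E : fieldType) (i : {rmorphism k -> E}) (P : set E).
Hypothesis P_place : place i P.
Variable t : E.
Hypotheses (t_ideal : place_ideal P t) (t_neq0 : t != 0).
Hypothesis t_unif : uniformizer i P t.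

Lemma place_degree1 : place_degree i P = 1%N.
Proof.
apply: (@quotient_dimE _ _ _ _ _ _ (fun=> 1)).
  split=> [|c z w]; first exact: place_ideal0 P_place.
  move=> mz mw; apply: (place_idealD P_place) => //.
  by apply: (place_idealM P_place) => //; apply: place_const.
split=> [_|z Pz]; first exact: place1 P_place.
have [c mc] : exists c, place_ideal P (z - i c).
  have [->|z0] := eqVneq z 0.
    by exists 0; rewrite rmorph0 subr0; apply: place_ideal0 P_place.
  have [n oz] := t_unif z0.
  move/(place_ord_ge0 P_place t_ideal t_neq0 oz): (Pz).
  rewrite le_eqVlt => /orP[/eqP n0|n0].
    by move: oz; rewrite -n0 => /place_ord0P[c _ mc]; exists c.
  exists 0; rewrite rmorph0 subr0.
  exact/(place_ord_gt0 P_place t_ideal t_neq0 oz).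
exists (const_mx c); split=> [|d /=]; rewrite big_ord1 mulr1;
  first by rewrite mxE.
move=> md; apply/rowP => j; rewrite ord1 mxE.
apply/eqP; rewrite -subr_eq0; apply/eqP/(place_ideal_const P_place).
have -> : i (c - d 0 0) = (z - i (d 0 0)) - (z - i c) by rewrite rmorphB; ring.
exact: place_idealB P_place _ _ md mc.
Qed.

End Degree.

(** * Existence of places *)

Section Extension.
Variables (k E : fieldType) (i : {rmorphism k -> E}) (u v : E).
Implicit Types (O : set E) (z : E).

(** The condition maximised in Chevalley's theorem: the ideal generated by [u] and [v] stays proper.
    Two generators suffice because the point [(a, b)] is cut out by [x - i a] and [y - i b]. *)
Definition proper_subring O : Prop :=
  [/\ O 1, forall z w, O z -> O w -> O (z - w) /\ O (z * w), O u, O v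
    & forall a b, O a -> O b -> u * a + v * b != 1].

Section Ideal.
Variable O : set E.
Hypothesis O_proper : proper_subring O.

Let OB z w : O z -> O w -> O (z - w).
Proof. by case: O_proper => _ H _ _ _ Oz Ow; case: (H z w Oz Ow). Qed.

Let OM z w : O z -> O w -> O (z * w).
Proof. by case: O_proper => _ H _ _ _ Oz Ow; case: (H z w Oz Ow). Qed.

Let O1 : O 1. Proof. by case: O_proper. Qed.

Let O0 : O 0. Proof. by rewrite -(subrr 1); apply: OB. Qed.

Let OD z w : O z -> O w -> O (z + w).
Proof. by move=> Oz Ow; rewrite -[w]opprK -(sub0r w); do 2!apply: OB => //. Qed.

Let J : set E := [set z | exists a b, [/\ O a, O b & z = u * a + v * b]].

Let JO z : J z -> O z.
Proof.
by case: O_proper => _ _ Ou Ov _ [a [b [Oa Ob ->]]]; apply: OD; apply: OM.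
Qed.

Let J1 : ~ J 1.
Proof.
by case: O_proper => _ _ _ _ H [a [b [Oa Ob /esym/eqP]]]; apply/negP/H.
Qed.

Let JD z w : J z -> J w -> J (z + w).
Proof.
move=> [a [b [Oa Ob ->]]] [a' [b' [Oa' Ob' ->]]].
exists (a + a'), (b + b'); split; [exact: OD|exact: OD|ring].
Qed.

Let JM z w : O z -> J w -> J (z * w).
Proof.
move=> Oz [a [b [Oa Ob ->]]]; exists (z * a), (z * b).
split; [exact: OM|exact: OM|ring].
Qed.

Let J0 : J 0. Proof. by exists 0, 0; split=> //; ring. Qed.

(** The descent of Chevalley's extension theorem: from two equations
    [1 = p(z)] and [1 = q(1/z)] of minimal degrees over the ideal [J],
    the leading term of the longer one can be eliminated. *)
Lemma no_inverse_equations n (p q : {poly E}) z : z != 0 ->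
  (size p + size q <= n)%N -> (forall l, J p`_l) -> (forall l, J q`_l) ->
  p.[z] = 1 -> q.[z^-1] = 1 -> False.
Proof.
elim: n p q z => [|n IH] p q z z0 sz Jp Jq pz qz.
  move: sz; rewrite leqn0 addn_eq0 !size_poly_eq0 => /andP[/eqP p0 _].
  by move/eqP: pz; rewrite p0 horner0 eq_sym oner_eq0.
wlog qp : p q z z0 sz Jp Jq pz qz / (size q <= size p)%N.
  move=> H; case: (leqP (size q) (size p)) => [|/ltnW] le;
    first exact: (H p q z).
  apply: (H q p z^-1) => //; rewrite ?invr_eq0 ?invrK //.
  by rewrite addnC.
have [p1|p2] := leqP (size p) 1.
  by apply: J1; rewrite -pz (size1_polyC p1) hornerC.
set s := (size p).-2; have sp : size p = s.+2 by rewrite /s; lia.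
set c := p`_s.+1; set d := q`_0.
(* [p0] is [p] without its leading term; [r] is the reversal of [q] without its constant term, so
   that [r(z) = z^(s+1) (1 - d)]. *)
pose p0 := \poly_(l < s.+1) p`_l; pose r := \poly_(l < s.+1) q`_(s.+1 - l).
have p0z : p0.[z] = 1 - c * z ^+ s.+1.
  by rewrite -pz horner_poly horner_coef sp [in RHS]big_ord_recr /= addrK.
have rz : r.[z] = z ^+ s.+1 * (1 - d).
  have -> : 1 - d = \sum_(l < s.+1) q`_l.+1 * z^-1 ^+ l.+1.
    rewrite -qz (@horner_coef_wide _ s.+2) -?sp // sp big_ord_recl /= expr0 mulr1.
    by rewrite addrC addKr.
  rewrite horner_poly (reindex_inj rev_ord_inj) /= mulr_sumr.
  apply: eq_bigr => l _; rewrite /= subSS.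
  have ls : (l <= s)%N by rewrite -ltnS.
  rewrite subSn ?leq_subr // subKn // mulrCA; congr (_ * _).
  by rewrite -[(s - l)%N]subSS exprVn expfB_cond // (negbTE z0).
(* At [z] this is [d + (1 - d) (1 - c z^(s+1)) + c z^(s+1) (1 - d) = 1], and the leading term of [p]
   is gone. *)
pose p' := d%:P + (1 - d) *: p0 + c *: r.
apply: (IH p' q z) => //.
- rewrite -ltnS; apply: leq_trans sz; rewrite ltn_add2r sp ltnS.
  apply: (leq_trans (size_polyD _ _)); rewrite geq_max; apply/andP; split.
    apply: (leq_trans (size_polyD _ _)); rewrite geq_max size_polyC.
    rewrite (leq_trans (leq_b1 _)) //=.
    by apply: (leq_trans (size_scale_leq _ _)); apply: size_poly.
  by apply: (leq_trans (size_scale_leq _ _)); apply: size_poly.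
- have Jc : J c by exact: Jp.
  have Jd : J d by exact: Jq.
  move=> l; rewrite !coefD !coefZ coefC !coef_poly; apply: JD; first apply: JD.
  + by case: ifP.
  + apply: JM; first by apply: OB => //; apply: JO.
    by case: ifP.
  + apply: JM; first exact: JO.
    by case: ifP.
- by rewrite !hornerD hornerC !hornerZ p0z rz; ring.
Qed.

Hypothesis O_max : forall O', proper_subring O' -> O `<=` O' -> O' `<=` O.

(** By maximality the ideal of [u] and [v] cannot stay proper in the larger ring [O[z]]; an
    expression of 1 there is an equation for [z] with coefficients in [J]. *)
Lemma maximal_not_mem z : ~ O z ->
  exists p : {poly E}, (forall l, J p`_l) /\ p.[z] = 1.
Proof.
move=> nOz; pose O' := [set w | exists2 p :
  {poly E}, (forall l, O p`_l) & w = p.[z]].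
have OO' : O `<=` O'.
  move=> w Ow; exists w%:P; last by rewrite hornerC.
  by move=> l; rewrite coefC; case: ifP.
case: (pselect (proper_subring O')) => [/O_max H|npr].
  exfalso; apply: nOz; apply: (H OO'); exists 'X; last by rewrite hornerX.
  by move=> l; rewrite coefX; case: (l == 1%N).
apply: contrapT => H; apply: npr; have [_ _ Ou Ov _] := O_proper.
split=> [||||_ _ [p Op ->] [q Oq ->]]; try exact: OO'.
- move=> _ _ [p Op ->] [q Oq ->]; split.
    by exists (p - q); rewrite ?hornerD ?hornerN // => l; rewrite coefB;
      apply: OB.
  exists (p * q); rewrite ?hornerM // => l; rewrite coefM.
  by apply: (big_ind O) => // ? _; apply: OM.
- apply/eqP => pq; apply: H; exists (u *: p + v *: q).
  split; last by rewrite hornerD !hornerZ.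
  by move=> l; exists p`_l, q`_l; rewrite coefD !coefZ.
Qed.

End Ideal.

Lemma place_extension B :
  proper_subring B -> range i `<=` B -> u != 0 ->
  exists P, [/\ place i P, B `<=` P, place_ideal P u & place_ideal P v].
Proof.
move=> Bpr iB u0.
(* Zorn's lemma also asks for the union of the empty chain; adding [B] to every member takes care of
   it. *)
have [|A [Apr Amax]] := @Zorn_bigcup _ [set A | proper_subring (A `|` B)].
  move=> F FP Ftot /=; have [[A0 FA0]|F0] := pselect (exists A, F A);
    last first.
    suff -> : \bigcup_(A in F) A `|` B = B by [].
    by rewrite setUidr // => z [A FA _]; exfalso; apply: F0; exists A.
  have up z w : (\bigcup_(A in F) A `|` B) z -> (\bigcup_(A in F) A `|` B) w ->
      exists2 A, F A & (A `|` B) z /\ (A `|` B) w.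
    move=> [[A FA Az]|Bz] [[A' FA' Aw]|Bw].
    - have [AA'|AA'] := Ftot _ _ FA FA'.
        by exists A' => //; split; left => //; apply: AA'.
      by exists A => //; split; left => //; apply: AA'.
    - by exists A => //; split; [left|right].
    - by exists A' => //; split; [right|left].
    - by exists A0 => //; split; right.
  have [B1 _ Bu Bv _] := Bpr.
  split; try by right.
  - move=> z w /up H /H [A FA [Az Aw]];
    have [_ /(_ _ _ Az Aw)[AB AM] _ _ _] := FP _ FA.
    have AU : A `|` B `<=` \bigcup_(A in F) A `|` B by apply: setSU => a;
      exists A.
    by split; apply: AU.
  - by move=> a b /up H /H [A FA [Az Aw]]; have [_ _ _ _] := FP _ FA; apply.
set P := A `|` B in Apr.
have Pmax O' : proper_subring O' -> P `<=` O' -> O' `<=` P.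
  move=> O'pr PO' z O'z; apply: contrapT => nPz.
  apply: (Amax O'); last by rewrite /= setUidl // => a Ba; apply: PO'; right.
  split; first by move=> a Aa; apply: PO'; left.
  by move=> /(_ z O'z) Az; apply: nPz; left.
have [P1 PBM Pu Pv Pno] := Apr.
have P0 : P 0 by rewrite -(subrr 1); case: (PBM 1 1 P1 P1).
have Ptot z : P z \/ P z^-1.
  apply: contrapT => /not_orP[nz nzV].
  have z0 : z != 0 by apply/eqP => z0; apply: nz; rewrite z0.
  have [p [Jp pz]] := maximal_not_mem Apr Pmax nz.
  have [q [Jq qz]] := maximal_not_mem Apr Pmax nzV.
  exact: (no_inverse_equations Apr z0 (leqnn _) Jp Jq).
have nuV : ~ P u^-1.
  by move=> PuV; move/eqP: (Pno _ _ PuV P0); rewrite mulfV // mulr0 addr0.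
have Pp : place i P.
  split=> //; split=> //.
  - by move=> z /iB; right.
  - move=> /(_ u Pu) [c _ cu]; apply: nuV; right; apply: iB.
    by exists c^-1 => //; rewrite fmorphV cu.
  - by move=> /(_ u^-1 I).
exists P; split=> //; first by move=> z; right.
  by apply/(place_idealE Pp); right.
apply/(place_idealE Pp); have [->|v0] := eqVneq v 0; [by left|right=> PvV].
by move/eqP: (Pno _ _ P0 PvV); rewrite mulfV // mulr0 add0r.
Qed.

End Extension.

(** * Riemann's inequality *)

Section Genus.
Variables (k E : fieldType) (i : {rmorphism k -> E}).
Hypothesis places_discrete : forall P, place i P ->
  exists t, [/\ place_ideal P t, t != 0 & uniformizer i P t].
Implicit Types (P Q : set E) (A B : set E -> int) (z w : E).

Lemma valuation_ord P z : place i P -> z != 0 ->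
  exists t, [/\ place_ideal P t, t != 0 & place_ord i P t z (valuation P z)].
Proof.
move=> Pp z0; have [t [mt t0 ut]] := places_discrete Pp.
have [n oz] := ut z z0; exists t; split=> //.
by rewrite (valuationE Pp mt t0 ut oz).
Qed.

Lemma valuationM P z w : place i P -> z != 0 -> w != 0 ->
  valuation P (z * w) = valuation P z + valuation P w.
Proof.
move=> Pp z0 w0; have [t [mt t0 ut]] := places_discrete Pp.
have [n oz] := ut z z0; have [l ow] := ut w w0.
rewrite (valuationE Pp mt t0 ut oz) (valuationE Pp mt t0 ut ow).
exact: (valuationE Pp mt t0 ut (place_ordM Pp t0 oz ow)).
Qed.

Lemma valuation_const P c : place i P -> c != 0 -> valuation P (i c) = 0.
Proof.
move=> Pp c0; have [t [mt t0 ut]] := places_discrete Pp.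
exact: (valuationE Pp mt t0 ut (place_ord_const Pp t c0)).
Qed.

Lemma valuationX P z n : place i P -> z != 0 ->
  valuation P (z ^+ n) = n%:Z * valuation P z.
Proof.
move=> Pp z0; elim: n => [|n IH].
  by rewrite expr0 mul0r -(rmorph1 i) valuation_const ?oner_neq0.
by rewrite exprS valuationM ?expf_neq0 // IH intS mulrDl mul1r.
Qed.

Definition valuation_ge P (n : int) :
  set E := [set z | z = 0 \/ n <= valuation P z].

Lemma valuation_geE P t n z : place i P -> place_ideal P t -> t != 0 ->
  uniformizer i P t -> valuation_ge P n z <-> P (z * t ^ (- n)).
Proof.
move=> Pp mt t0 ut; have [->|z0] := eqVneq z 0.
  by rewrite mul0r; split=> [_|_]; [apply: place0 Pp | left].
have [l oz] := ut z z0; have vz := valuationE Pp mt t0 ut oz.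
have osz := place_ord_shift Pp t0 (- n) oz.
split=> [[/eqP|]|/(place_ord_ge0 Pp mt t0 osz)]; first by rewrite (negbTE z0).
  by rewrite vz => ln; apply/(place_ord_ge0 Pp mt t0 osz); rewrite subr_ge0.
by rewrite subr_ge0 => ln; right; rewrite vz.
Qed.

Lemma valuation_ge_subspace P n : place i P -> subspace i (valuation_ge P n).
Proof.
move=> Pp; have [t [mt t0 ut]] := places_discrete Pp; split; first by left.
move=> c z w /(valuation_geE n z Pp mt t0 ut) Pz /(valuation_geE n w Pp mt t0 ut) Pw.
apply/(valuation_geE n _ Pp mt t0 ut); rewrite mulrDl; apply: (placeD Pp) => //.
by rewrite -mulrA; apply: (placeM Pp) => //; apply: place_const.
Qed.

(** As residues are constants, a suitable multiple of [w] has the same leading term as [z];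
    consecutive steps of the valuation filtration differ by dimension at most one. *)
Lemma valuation_residue P z w : place i P -> w != 0 ->
  valuation_ge P (valuation P w) z ->
  exists c, valuation_ge P (valuation P w + 1) (z - i c * w).
Proof.
move=> Pp w0 [->|zw]; first by exists 0; left; rewrite rmorph0 mul0r subr0.
have [->|z0] := eqVneq z 0; first by exists 0; left;
  rewrite rmorph0 mul0r subr0.
have [wz|zw'] := ltP (valuation P w) (valuation P z).
  by exists 0; right; rewrite rmorph0 mul0r subr0; lia.
have [t [mt t0 ut]] := places_discrete Pp.
have [n oz] := ut z z0; have [l ow] := ut w w0.
have vz := valuationE Pp mt t0 ut oz; have vw := valuationE Pp mt t0 ut ow.
have : place_ord i P t (z / w) 0.
  have -> : 0 = n - l by lia.
  by apply: (place_ordM Pp t0) => //; apply: (place_ordV Pp).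
move=> /place_ord0P [c _ mc]; exists c.
have [->|zcw] := eqVneq (z - i c * w) 0; [by left|right].
rewrite -[z - _](mulfVK w0) mulrBl mulfK // in zcw *.
move: zcw; rewrite mulf_eq0 negb_or w0 andbT => zcw.
rewrite valuationM // addrC lerD2r.
have [h oh] := ut _ zcw; rewrite (valuationE Pp mt t0 ut oh).
by move/(place_ord_gt0 Pp mt t0 oh): mc; lia.
Qed.

(** * Riemann-Roch spaces and degrees of divisors *)

Local Notation L := (riemann_roch_space i).

Lemma riemann_roch_spaceE A z :
  L A z <-> forall P, place i P -> valuation_ge P (- A P) z.
Proof.
split=> [[-> P _|H P Pp]|H]; [by left | by right; apply: H|].
have [->|z0] := eqVneq z 0; [by left|right=> P Pp].
by case: (H P Pp) => // /eqP; rewrite (negbTE z0).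
Qed.

Lemma riemann_roch_subspace A : subspace i (L A).
Proof.
split; first by left.
move=> c z w /riemann_roch_spaceE Lz /riemann_roch_spaceE Lw.
apply/riemann_roch_spaceE => P Pp.
by have [_ H] := valuation_ge_subspace (- A P) Pp; apply: H;
  [exact: Lz|exact: Lw].
Qed.

Lemma riemann_roch_le A B :
  (forall P, place i P -> A P <= B P) -> L A `<=` L B.
Proof.
move=> AB z [->|H]; [by left|right=> P Pp].
by apply: le_trans (H P Pp); rewrite lerN2; apply: AB.
Qed.

Lemma riemann_roch_eq A B : (forall P, place i P -> A P = B P) -> L A = L B.
Proof.
by move=> AB; apply/seteqP; split; apply: riemann_roch_le => P /AB ->.
Qed.

Definition add_place A P (c : int) : set E -> int :=
  fun P' => A P' + (if P' == P then c else 0).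

Lemma riemann_roch_step A P n b : place i P -> has_dim i (L A) n ->
  L (add_place A P 1) b -> ~ L A b -> has_dim i (L (add_place A P 1)) n.+1.
Proof.
move=> Pp dA Lb nLb.
have LA : L A `<=` L (add_place A P 1).
  apply: riemann_roch_le => P' _; rewrite /add_place lerDl.
  by case: ifP.
have b0 : b != 0 by apply: contra_notN nLb => /eqP ->; left.
have vb : valuation P b = - (A P + 1).
  case: Lb => [/eqP|Lb]; first by rewrite (negbTE b0).
  have := Lb P Pp; rewrite /add_place eqxx => vb; apply/eqP;
    rewrite eq_le vb andbT.
  rewrite leNgt; apply/negP => vb'; apply: nLb; right=> P' P'p.
  have := Lb P' P'p; rewrite /add_place; case: eqP => [-> _|_];
    last by rewrite addr0.
  by lia.
apply: (has_dimS (riemann_roch_subspace A) dA Lb nLb) => //.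
  exact: riemann_roch_subspace.
move=> z Lz; have [|c cP] := @valuation_residue P z b Pp b0.
  by rewrite vb; move/riemann_roch_spaceE/(_ P Pp): Lz; rewrite /add_place eqxx.
exists c; apply/riemann_roch_spaceE => P' P'p.
have [->|P'P] := eqVneq P' P.
  by move: cP; rewrite vb; congr (valuation_ge _ _ _); lia.
move/riemann_roch_spaceE/(_ P' P'p): (Lz);
  move/riemann_roch_spaceE/(_ P' P'p): (Lb).
rewrite /add_place (negbTE P'P) addr0 => Lb' Lz'.
have [_ H] := valuation_ge_subspace (- A P') P'p.
by have := H (- c) _ _ Lz' Lb'; rewrite rmorphN mulNr.
Qed.

Lemma riemann_roch_step_eq A P : place i P ->
  (forall b, L (add_place A P 1) b -> L A b) -> L (add_place A P 1) = L A.
Proof.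
move=> Pp H; apply/seteqP; split=> //; apply: riemann_roch_le => P' _.
by rewrite /add_place lerDl; case: ifP.
Qed.

(** A common list for two divisors lets their degrees be compared as finite sums over the same
    places. *)
Lemma divisor_support A B : is_divisor i A -> is_divisor i B ->
  exists s : seq (set E), [/\ uniq s, forall P, P \in s -> place i P
    & forall P, place i P -> P \notin s -> A P = 0 /\ B P = 0].
Proof.
move=> /finite_seqP[s sE] /finite_seqP[s' sE']; exists (undup (s ++ s')).
have inE P : (P \in undup (s ++ s')) = (P \in s) || (P \in s').
  by rewrite mem_undup mem_cat.
split=> [|P|P Pp]; first exact: undup_uniq.
  rewrite inE => /orP[Ps|Ps].
    by have [] : [set P | place i P /\ A P != 0] P by rewrite sE.
  by have [] : [set P | place i P /\ B P != 0] P by rewrite sE'.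
rewrite inE negb_or => /andP[/negP Ps /negP Ps']; split; apply/eqP;
  apply/negPn/negP.
  move=> AP; apply: Ps; have : [set` s] P by rewrite -sE.
  by [].
move=> AP; apply: Ps'; have : [set` s'] P by rewrite -sE'.
by [].
Qed.

Lemma degree_seq A (s : seq (set E)) :
  uniq s -> (forall P, P \in s -> place i P) ->
  (forall P, place i P -> P \notin s -> A P = 0) ->
  divisor_degree i A = \sum_(P <- s) A P.
Proof.
move=> us sp sA; rewrite /divisor_degree (fsbigE s) //.
- rewrite big_seq_cond [RHS]big_seq; apply: eq_big => [P|P /andP[/sp Pp _]].
    by apply: andb_idr => /sp Pp; rewrite inE.
  by have [t [mt t0 ut]] := places_discrete Pp;
    rewrite (place_degree1 Pp mt t0 ut) mulr1.
- by move=> P Pp /(sA P Pp) ->; rewrite mul0r.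
Qed.

Lemma is_divisorP A (s : seq (set E)) :
  (forall P, place i P -> P \notin s -> A P = 0) -> is_divisor i A.
Proof.
move=> sA; apply: (@sub_finite_set _ _ [set` s]); last exact: finite_seq.
move=> P [Pp AP] /=; apply: contraNT AP => Ps.
by rewrite (sA P Pp Ps).
Qed.

Lemma divisorB A B : is_divisor i A -> is_divisor i B ->
  is_divisor i (fun P => A P - B P) /\
  divisor_degree i (fun P =>
    A P - B P) = divisor_degree i A - divisor_degree i B.
Proof.
move=> dA dB; have [s [us sp sAB]] := divisor_support dA dB.
have sB P : place i P -> P \notin s -> A P - B P = 0.
  by move=> Pp Ps; have [-> ->] := sAB P Pp Ps; rewrite subr0.
split; first exact: is_divisorP sB.
rewrite !(degree_seq us sp) ?sumrB // => P Pp Ps; by case: (sAB P Pp Ps).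
Qed.

Lemma divisor0 : is_divisor i (fun=> 0) /\ divisor_degree i (fun=> 0) = 0.
Proof.
by split; [apply: (@is_divisorP _ [::]) | rewrite (@degree_seq _ [::]) ?big_nil].
Qed.

Lemma divisor_add_place A P c : is_divisor i A -> place i P ->
  is_divisor i (add_place A P c) /\
  divisor_degree i (add_place A P c) = divisor_degree i A + c.
Proof.
move=> dA Pp; have [s [us sp sA]] := divisor_support dA dA.
have [s' [us' sE']] : exists s', uniq s' /\ s' =i P :: s.
  by exists (undup (P :: s)); split; [exact: undup_uniq | exact: mem_undup].
have sp' P' : P' \in s' -> place i P'.
  by rewrite sE' inE => /orP[/eqP->//|]; apply: sp.
have sA' P' : place i P' -> P' \notin s' -> A P' = 0.
  by move=> Pp'; rewrite sE' inE negb_or => /andP[_ /(sA P' Pp')[]].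
have sB P' : place i P' -> P' \notin s' -> add_place A P c P' = 0.
  move=> Pp' Ps; rewrite /add_place (sA' P' Pp' Ps) add0r.
  by move: Ps; rewrite sE' inE negb_or => /andP[/negbTE -> _].
split; first exact: is_divisorP sB.
rewrite !(degree_seq us' sp') // big_split /=; congr (_ + _).
have Ps' : P \in s' by rewrite sE' inE eqxx.
by rewrite (bigD1_seq P) //= eqxx big1 ?addr0 // => P' /negbTE ->.
Qed.

(** Each added place raises the dimension by at most one. A finite basis is part of the conclusion,
    because [quotient_dim] would be 0 on an infinite-dimensional space. *)
Lemma riemann_roch_chain A B n (N : nat) : is_divisor i A -> is_divisor i B ->
  (forall P, place i P -> A P <= B P) ->
  divisor_degree i B - divisor_degree i A = N%:Z -> has_dim i (L A) n ->
  exists2 n', (n' <= n + N)%N & has_dim i (L B) n'.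
Proof.
elim: N A n => [|N IH] A n dA dB AB degN dimA.
  exists n; rewrite ?addn0 //; rewrite -(@riemann_roch_eq A) // => P Pp.
  have [s [us sp sAB]] := divisor_support dB dA.
  have [Ps|/(sAB P Pp)[-> ->//]] := boolP (P \in s).
  move: degN; have [_ <-] := divisorB dB dA.
  rewrite (degree_seq us sp); last first.
    by move=> P' Pp' Ps'; have [-> ->] := sAB P' Pp' Ps'; rewrite subr0.
  rewrite (bigD1_seq P) //=; set S := \sum_(_ <- _ | _) _ => sum0.
  have := AB P Pp; suff : 0 <= S by lia.
  rewrite /S big_seq_cond sumr_ge0 // => P' /andP[Ps' _].
  by rewrite subr_ge0; apply: AB; apply: sp.
have [P [Pp ABP]] : exists P, place i P /\ A P < B P.
  apply: contrapT => H; have eAB P : place i P -> A P = B P.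
    move=> Pp; apply/eqP; rewrite eq_le AB //= leNgt; apply/negP => ?.
    by apply: H; exists P.
  have [s [us sp sAB]] := divisor_support dB dA.
  move: degN; rewrite !(degree_seq us sp); try by move=> P Pp /(sAB P Pp)[].
  have -> : \sum_(P <- s) B P = \sum_(P <- s) A P.
    by apply: eq_big_seq => P /sp /eAB.
  by rewrite subrr.
have [dA' degA'] := divisor_add_place 1 dA Pp.
have [n' [nn' dimA']] :
  exists n', (n' <= n.+1)%N /\ has_dim i (L (add_place A P 1)) n'.
  have [[b [Lb nLb]]|H] := pselect (exists b, L (add_place A P 1) b /\ ~ L A b).
    by exists n.+1; split=> //; apply: riemann_roch_step Lb nLb.
  exists n; split=> //; rewrite riemann_roch_step_eq // => b Lb.
  by apply: contrapT => nLb; apply: H; exists b.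
have [||n'' le dimB] := IH _ n' dA' dB _ _ dimA'.
- move=> P' Pp'; rewrite /add_place; case: eqP => [->|_];
  last by rewrite addr0 AB.
  by lia.
- by rewrite degA'; lia.
by exists n'' => //; lia.
Qed.

(** Multiplication by [z] is an isomorphism between the two spaces: linearly equivalent divisors
    have the same dimension. *)
Lemma has_dim_mul A z n : z != 0 ->
  has_dim i (L (fun P => A P - valuation P z)) n -> has_dim i (L A) n.
Proof.
move=> z0 [b [Lb bP]].
have LM w : L A w <-> L (fun P => A P - valuation P z) (w * z).
  have [->|w0] := eqVneq w 0; first by rewrite mul0r; split=> _; left.
  split=> [] [/eqP|H]; rewrite ?(negbTE w0) //; last 2 first.
  - by rewrite mulf_eq0 (negbTE w0) (negbTE z0).
  - right=> P Pp; have := H P Pp; rewrite valuationM //; lia.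
  - right=> P Pp; have := H P Pp; rewrite valuationM //; lia.
exists (fun j => b j / z); split=> [j|w /LM /bP [c [/= cP cu]]].
  by apply/LM; rewrite divfK.
have sumE (d : 'rV_n) : w - \sum_j i (d 0 j) * (b j / z) =
    (w * z - \sum_j i (d 0 j) * b j) / z.
  rewrite mulrBl mulfK // mulr_suml; congr (_ - _).
  by apply: eq_bigr => j _; rewrite mulrA.
exists c; split=> [|d] /=; rewrite sumE; first by rewrite cP mul0r.
by move/eqP; rewrite mulf_eq0 invr_eq0 (negbTE z0) orbF => /eqP /cu.
Qed.

(** * Pole orders at a distinguished place, and the genus *)

Variable Q : set E.
Hypothesis Q_place : place i Q.
(** Subtracting a multiple of the divisor of such a [z] removes the positive part of a divisor at
    [P] at the expense of [Q], without change of degree. For the curve, [z] will be [x - i a]. *)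
Hypothesis place_killer : forall P, place i P -> P != Q -> exists z,
  [/\ z != 0, 0 < valuation P z,
      forall P', place i P' -> P' != Q -> 0 <= valuation P' z,
      is_divisor i (fun P' => valuation P' z)
    & divisor_degree i (fun P' => valuation P' z) = 0].

Lemma divisor_valuationX z n : z != 0 -> is_divisor i (fun P =>
  valuation P z) ->
  divisor_degree i (fun P => valuation P z) = 0 ->
  is_divisor i (fun P => valuation P (z ^+ n)) /\
  divisor_degree i (fun P => valuation P (z ^+ n)) = 0.
Proof.
move=> z0 dz degz; have [s [us sp sz]] := divisor_support dz dz.
have szn P : place i P -> P \notin s -> valuation P (z ^+ n) = 0.
  by move=> Pp Ps; rewrite valuationX //; have [-> _] := sz P Pp Ps;
    rewrite mulr0.
split; first exact: is_divisorP szn.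
rewrite (degree_seq us sp szn) big_seq.
rewrite (eq_bigr (fun P => n%:Z * valuation P z)); last first.
  by move=> P /sp Pp; rewrite valuationX.
rewrite -big_seq -mulr_sumr -(degree_seq us sp) ?degz ?mulr0 // => P Pp Ps.
by case: (sz P Pp Ps).
Qed.

Lemma clear_finite_places A (s : seq (set E)) : is_divisor i A ->
  (forall P, place i P -> P != Q -> 0 < A P -> P \in s) ->
  exists z, [/\ z != 0, is_divisor i (fun P => A P - valuation P z),
    divisor_degree i (fun P => A P - valuation P z) = divisor_degree i A
    & forall P, place i P -> P != Q -> A P - valuation P z <= 0].
Proof.
elim: s A => [|P s IH] A dA sA.
  have v1 P : place i P -> valuation P 1 = 0.
    by move=> Pp; rewrite -(rmorph1 i) valuation_const ?oner_neq0.
  have d1 : is_divisor i (fun P => valuation P 1).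
    by apply: (@is_divisorP _ [::]) => P /v1.
  have [dA1 degA1] := divisorB dA d1.
  exists 1; split=> //; first exact: oner_neq0.
    by rewrite degA1 (@degree_seq (fun P =>
      valuation P 1) [::]) ?big_nil ?subr0 // => P /v1.
  move=> P Pp PQ; rewrite v1 // subr0 leNgt; apply/negP => /sA.
  by move=> /(_ Pp PQ).
have [[Pp PQ]|H] := pselect (place i P /\ P != Q); last first.
  apply: (IH A dA) => P' Pp' PQ' AP'; have := sA P' Pp' PQ' AP'.
  by rewrite inE => /orP[/eqP PP|//]; exfalso; apply: H; rewrite -PP.
have [z [z0 vz vz' dz degz]] := place_killer Pp PQ.
(* Since [z] vanishes at [P], subtracting [n] times its divisor makes the coefficient at [P]
   nonpositive, and can raise only the one at [Q]. *)
pose n := `|A P|%N.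
have [dzn degzn] := divisor_valuationX n z0 dz degz.
have [dA' degA'] := divisorB dA dzn.
have [|w [w0 dw degw wP]] := IH _ dA'.
  move=> P' Pp' PQ'; rewrite valuationX // => AP'.
  have v' := vz' P' Pp' PQ'.
  have : P' \in P :: s by apply: sA => //; apply: lt_le_trans AP' _;
    rewrite gerBl mulr_ge0.
  rewrite inE => /orP[/eqP PP|//]; move: AP'; rewrite PP /n.
  by move: vz; rewrite subr_gt0 ltNge => vz; nia.
have eqv P' : place i P' ->
    A P' - valuation P' (z ^+ n * w) =
      A P' - valuation P' (z ^+ n) - valuation P' w.
  by move=> Pp'; rewrite valuationM ?expf_neq0 // opprD addrA.
have [t [ut tp tA]] := divisor_support dw dw.
exists (z ^+ n * w); split.
- by rewrite mulf_neq0 ?expf_neq0.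
- by apply: (@is_divisorP _ t) => P' Pp' Pt; rewrite eqv //;
  case: (tA P' Pp' Pt).
- rewrite -[RHS]subr0 -degzn -degA' -degw !(degree_seq ut tp).
  + by apply: eq_big_seq => P' /tp /eqv.
  + by move=> P' Pp' Pt; case: (tA P' Pp' Pt).
  + by move=> P' Pp' Pt; rewrite eqv //; case: (tA P' Pp' Pt).
- by move=> P' Pp' PQ'; rewrite eqv //; apply: wP.
Qed.

Variable H : set nat.
Hypothesis regular_pole : forall z, z != 0 ->
  (forall P, place i P -> P != Q -> 0 <= valuation P z) ->
  exists2 s, H s & valuation Q z = - s%:Z.
Hypothesis pole_regular : forall s, H s -> exists z, [/\ z != 0,
  valuation Q z = - s%:Z & forall P, place i P -> P != Q -> 0 <= valuation P z].

Lemma weierstrass_semigroupE : weierstrass_semigroup i Q = H.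
Proof.
apply/seteqP; split=> [s [z [z0 zP]]|s /pole_regular[z [z0 vQ vP]]].
  have [P Pp PQ|s' Hs' vQ] := regular_pole z0.
    have := zP P Pp; rewrite /pole_divisor (negbTE PQ) => /max_idPl.
    by rewrite oppr_le0.
  by have := zP Q Q_place;
    rewrite /pole_divisor eqxx vQ opprK max_r // => -[<-].
exists z; split=> // P Pp; rewrite /pole_divisor; case: eqP => [->|/eqP PQ].
  by rewrite vQ opprK max_r.
by rewrite max_l // oppr_le0; apply: vP.
Qed.

Definition multiple_of_Q (n : int) : set E -> int := add_place (fun=> 0) Q n.

(** The index [n - 1] starts the induction at [- Q], whose space is zero because a nonzero function
    regular outside [Q] has order at most 0 there. One more order of pole adds a dimension exactly
    when that order lies in [H]. *)
Lemma dim_multiple (n : nat) :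
  has_dim i (L (multiple_of_Q (n%:Z - 1))) (\sum_(s < n) `[< H s >])%N.
Proof.
elim: n => [|n IH].
  rewrite big_ord0 sub0r.
  suff -> : L (multiple_of_Q (- 1)) = [set 0] by exact: has_dim0.
  apply/seteqP; split=> [z Lz|z ->]; last by left.
  apply: contrapT => /eqP z0; case: Lz => [/eqP|Lz]; first exact/negP.
  have [P Pp PQ|s Hs vQ] := regular_pole z0.
    by have := Lz P Pp; rewrite /multiple_of_Q /add_place (negbTE PQ).
  by have := Lz Q Q_place; rewrite /multiple_of_Q /add_place eqxx vQ; lia.
rewrite big_ord_recr /=.
have -> : multiple_of_Q (n.+1%:Z - 1) =
  add_place (multiple_of_Q (n%:Z - 1)) Q 1.
  apply/funext => P; rewrite /multiple_of_Q /add_place; case: ifP => _; lia.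
case: asboolP => [Hn|nHn].
  rewrite addn1; have [z [z0 vQ vP]] := pole_regular Hn.
  apply: (@riemann_roch_step _ _ _ z) => //.
    right=> P Pp; rewrite /multiple_of_Q /add_place; case: eqP => [->|/eqP PQ].
      by rewrite vQ; lia.
    by have := vP P Pp PQ; lia.
  case=> [/eqP|/(_ Q Q_place)]; first exact/negP.
  by rewrite vQ /multiple_of_Q /add_place eqxx; lia.
rewrite addn0 riemann_roch_step_eq // => z [->|Lz]; first by left.
have [->|z0] := eqVneq z 0; [by left|right=> P Pp].
have [P' Pp' PQ'|s Hs vQ] := regular_pole z0.
  by have := Lz P' Pp'; rewrite /multiple_of_Q /add_place (negbTE PQ').
have sn : s != n by apply: contra_notN nHn => /eqP <-.
have := Lz P Pp; rewrite /multiple_of_Q /add_place; case: eqP => [->|_];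
  last by [].
by rewrite vQ; lia.
Qed.

Lemma divisor_multiple n : is_divisor i (multiple_of_Q n) /\
  divisor_degree i (multiple_of_Q n) = n.
Proof.
have [d0 deg0] := divisor0; have := divisor_add_place n d0 Q_place.
by rewrite deg0 add0r.
Qed.

Variable g : nat.
(** Arbitrarily large [n] are asked for, rather than all large [n], as gaps will be counted on
    intervals whose length is a multiple of [m]. *)
Hypothesis gap_count :
  forall N, exists2 n, (N <= n)%N & (\sum_(s < n) `[< H s >] + g = n)%N.

Lemma riemann_inequality A : is_divisor i A ->
  divisor_degree i A - (riemann_roch_dim i A)%:Z + 1 <= g%:Z.
Proof.
move=> dA; have [s [us sp sA]] := divisor_support dA dA.
have [|z [z0 dA' <- A'P]] := @clear_finite_places A s dA.
  move=> P Pp PQ AP; apply: contraTT AP => Ps; rewrite -leNgt.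
  by have [-> _] := sA P Pp Ps.
set A' := fun P => A P - valuation P z in dA' A'P *.
(* A divisor below both [A'] and [- Q] has zero space; climbing from it to [A'] shows that [L A'] is
   finite-dimensional. *)
pose A'' := fun P => Num.min (A' P) (multiple_of_Q (- 1) P).
have [dQ degQ] := divisor_multiple (- 1).
have dA'' : is_divisor i A''.
  have [t [ut tp tA]] := divisor_support dA' dQ;
    apply: (@is_divisorP _ t) => P Pp Pt.
  by rewrite /A''; have [-> ->] := tA P Pp Pt; rewrite minxx.
have dim'' : has_dim i (L A'') 0.
  suff -> : L A'' = [set 0] by exact: has_dim0.
  apply/seteqP; split=> [w|w ->]; last by left.
  have := dim_multiple 0; rewrite big_ord0 sub0r => dim0.
  have /riemann_roch_le sub P : place i P -> A'' P <= multiple_of_Q (- 1) P.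
    by rewrite ge_min lexx orbT.
  move=> /sub Lw; apply: contrapT => /eqP w0.
  case: Lw => [/eqP|Lw]; first exact/negP.
  have [P Pp PQ|s' _ vQ] := regular_pole w0.
    by have := Lw P Pp; rewrite /multiple_of_Q /add_place (negbTE PQ).
  by have := Lw Q Q_place; rewrite /multiple_of_Q /add_place eqxx vQ; lia.
have deg_le B B' : is_divisor i B -> is_divisor i B' ->
    (forall P, place i P -> B P <= B' P) ->
      divisor_degree i B <= divisor_degree i B'.
  move=> dB dB' BB'; have [t [ut tp tB]] := divisor_support dB dB'.
  rewrite !(degree_seq ut tp); try by move=> P Pp /(tB P Pp)[].
  by rewrite big_seq [X in _ <= X]big_seq; apply: ler_sum => P /tp /BB'.
have A''A' P : place i P -> A'' P <= A' P by rewrite ge_min lexx.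
have [|a _ dimA'] := @riemann_roch_chain A'' A' 0
    `|divisor_degree i A' - divisor_degree i A''|%N dA'' dA' A''A' _ dim''.
  by rewrite gez0_abs // subr_ge0; apply: deg_le.
(* For this [n], [A'] lies below [(n - 1) Q], whose dimension is [n - g]; the chain bound
   [n - g <= l(A') + (n - 1) - deg A'] is the claim. *)
have [n nA gn] := gap_count `|A' Q|.+1.
have [dn degn] := divisor_multiple (n%:Z - 1).
have A'n P : place i P -> A' P <= multiple_of_Q (n%:Z - 1) P.
  move=> Pp; rewrite /multiple_of_Q /add_place add0r; case: eqP => [->|/eqP PQ].
    by lia.
  exact: A'P.
have le := deg_le _ _ dA' dn A'n; rewrite degn in le.
have [|b bN dimn] := @riemann_roch_chain A' _ a
    (absz (n%:Z - 1 - divisor_degree i A')%R) dA' dn A'n _ dimA'.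
  by rewrite degn gez0_abs // subr_ge0.
have bE := has_dim_uniq dimn (dim_multiple n).
rewrite /riemann_roch_dim (has_dimE (has_dim_mul z0 dimA')).
move: bN; rewrite bE; move: gn; lia.
Qed.

Lemma genusE : genus i = g.
Proof.
have [n _ gn] := gap_count 0; have [dn degn] := divisor_multiple (n%:Z - 1).
have ln : riemann_roch_dim i (multiple_of_Q (n%:Z - 1)) =
  (\sum_(s < n) `[< H s >])%N.
  exact: has_dimE (dim_multiple n).
apply: xget_unique => [|g' [[A [dA degA] g'P]]].
  split; last exact: riemann_inequality.
  (* The bound is attained: [(n - 1) - (n - g) + 1 = g]. *)
  by exists (multiple_of_Q (n%:Z - 1)); split=> //; rewrite degn ln; lia.
have := riemann_inequality dA; rewrite degA; have := g'P _ dn.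
by rewrite degn ln; lia.
Qed.

End Genus.

(** * Places of the Kummer extension *)

Section Kummer.
Variables (K : closedFieldType) (E : fieldType) (i :
  {rmorphism K -> E}) (x y : E).
Variables (m r : nat) (alpha : 'I_r -> K) (lambda : 'I_r -> nat).
Hypotheses (m_gt1 : (1 < m)%N) (m_neq0 : m%:R != 0 :> K).
Hypothesis alpha_inj : injective alpha.
Hypothesis lambda_coprime : forall l, coprime (lambda l) m.
Hypothesis lambda_gt0 : forall l, (0 < lambda l)%N.
Hypothesis lambda0_coprime : coprime (\sum_l lambda l)%N m.
Hypothesis x_transc : ~ algebraicOver i x.
Hypothesis xy_eq : y ^+ m = \prod_(l < r) (x - i (alpha l)) ^+ lambda l.
Hypothesis xy_gen : generated2 i x y.
Variable Q : set E.
Hypotheses (Q_place : place i Q) (Qx : ~ Q x).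

Definition evx : {rmorphism {poly K} -> E} := horner_eval x \o map_poly i.

Definition evxy : {rmorphism {poly {poly K}} ->
  E} := horner_eval y \o map_poly evx.

Let f : {poly K} := \prod_(l < r) ('X - (alpha l)%:P) ^+ lambda l.

Lemma evxE h : evx h = (map_poly i h).[x].
Proof. by []. Qed.

Lemma evxyE F : evxy F = (map_poly evx F).[y].
Proof. by []. Qed.

#[local] Opaque evx evxy.

Lemma evxC c : evx c%:P = i c.
Proof. by rewrite evxE map_polyC hornerC. Qed.

Lemma evxX : evx 'X = x.
Proof. by rewrite evxE map_polyX hornerX. Qed.

Lemma evx_XsubC a : evx ('X - a%:P) = x - i a.
Proof. by rewrite rmorphB evxX evxC. Qed.

Lemma evx_eq0 h : (evx h == 0) = (h == 0).
Proof.
apply/eqP/eqP => [h0|->]; last exact: rmorph0.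
by apply: contrapT => /eqP hn0; apply: x_transc; exists h => //; apply/rootP.
Qed.

Lemma evx_f : evx f = y ^+ m.
Proof.
rewrite xy_eq rmorph_prod; apply: eq_bigr => l _.
by rewrite rmorphXn evx_XsubC.
Qed.

Lemma evxyC h : evxy h%:P = evx h.
Proof. by rewrite evxyE map_polyC hornerC. Qed.

Lemma evxyX : evxy 'X = y.
Proof. by rewrite evxyE map_polyX hornerX. Qed.

Lemma y_neq0 : y != 0.
Proof.
have : y ^+ m != 0.
  rewrite -evx_f evx_eq0; apply/prodf_neq0 => l _.
  by rewrite expf_neq0 // polyXsubC_eq0.
by rewrite expf_eq0 negb_and -leqNgt leqNgt ltnW.
Qed.

Lemma x_sub_neq0 a : x - i a != 0.
Proof. by rewrite -evx_XsubC evx_eq0 polyXsubC_eq0. Qed.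

(** In [generated2] the outer variable stands for [x]; exchanging the variables puts [y] outside, so
    that division by the monic [Y^m - f] is possible. *)
Lemma generated2_evxy (N : {poly {poly K}}) :
  exists F, (map_poly (map_poly i) N).[x%:P].[y] = evxy F.
Proof.
elim/poly_ind: N => [|N c [F FE]].
  by exists 0; rewrite !rmorph0 !horner0.
exists (F * ('X)%:P + map_poly polyC c).
have -> : evxy (F * ('X)%:P + map_poly polyC c) =
  evxy F * x + (map_poly i c).[y].
  rewrite rmorphD rmorphM evxyC evxX [evxy (map_poly _ _)]evxyE -map_poly_comp.
  by congr (_ + _.[_]); apply: eq_map_poly => d; rewrite -evxC.
rewrite -FE rmorphD rmorphM /= map_polyX map_polyC /= hornerMXaddC.
by rewrite hornerD hornerM hornerC.
Qed.

Lemma evxy_integral F : integralOver evx (evxy F).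
Proof.
apply: integral_horner => [z /(nthP 0) [j _ <-]|].
  by rewrite coef_map; apply: integral_id.
exists ('X^m - f%:P).
  by rewrite monicXnsubC // ltnW.
have -> : map_poly evx ('X^m - f%:P) = 'X^m - (evx f)%:P.
  by rewrite rmorphB /= map_polyXn map_polyC.
by rewrite rootE hornerD hornerN hornerXn hornerC evx_f subrr.
Qed.

(** Clearing the constant term of an integral equation of [evxy F]
    provides a substitute for the norm to [K[x]]. *)
Lemma evxy_norm F : evxy F != 0 ->
  exists2 g, g != 0 & exists G, evx g = evxy F * evxy G.
Proof.
move=> F0; have [p /monic_neq0 p0 /rootP] := evxy_integral F.
elim/poly_ind: p p0 => [|p c IH] p0; first by rewrite eqxx in p0.
rewrite rmorphD rmorphM /= map_polyX map_polyC /= hornerMXaddC.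
have [c0|c0 pF] := eqVneq c 0.
  rewrite c0 rmorph0 addr0 => /eqP;
    rewrite mulf_eq0 (negbTE F0) orbF => /eqP; apply: IH.
  by apply: contra_neq p0 => ->; rewrite c0 mul0r polyC0 addr0.
exists c => //; exists (- (map_poly polyC p).[F]); apply/eqP.
rewrite rmorphN mulrN -addr_eq0 addrC -pF; apply/eqP; congr (_ + _).
rewrite mulrC; congr (_ * _); rewrite -horner_map.
congr (_.[_]); rewrite -map_poly_comp; apply: eq_map_poly => d.
by rewrite /= evxyC.
Qed.

Definition floor_poly (j : nat) : {poly K} :=
  \prod_(l < r) ('X - (alpha l)%:P) ^+ ((j * lambda l) %/ m).

Definition basis_fn (j : nat) : E := y ^+ j / evx (floor_poly j).

Lemma floor_poly_neq0 j : floor_poly j != 0.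
Proof. by apply/prodf_neq0 => l _; rewrite expf_neq0 // polyXsubC_eq0. Qed.

Lemma basis_fn_neq0 j : basis_fn j != 0.
Proof.
by rewrite mulf_neq0 ?expf_neq0 ?y_neq0 // invr_eq0 evx_eq0 floor_poly_neq0.
Qed.

(** The floors in the denominator leave exactly the remainders modulo [m]. Regularity outside [Q]
    and the pole order at [Q] are both read off from this power. *)
Lemma basis_fn_exp j :
  basis_fn j ^+ m = \prod_(l < r) (x - i (alpha l)) ^+ ((j * lambda l) %% m).
Proof.
rewrite /basis_fn expr_div_n -rmorphXn exprAC -evx_f -rmorphXn.
apply: (canLR (mulfK _)); first by rewrite evx_eq0 expf_neq0 // floor_poly_neq0.
under [X in _ = X * _]eq_bigr do rewrite -evx_XsubC -rmorphXn.
rewrite -rmorph_prod -rmorphM -!prodrXl -big_split /=; congr (evx _).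
apply: eq_bigr => l _; rewrite -!exprM -exprD mulnC addnC.
by rewrite -divn_eq.
Qed.

(** The norm substitute moves the denominator into [K[x]], and reduction modulo [Y^m - f] leaves
    degree less than [m] in [y]; the factor [floor_poly j] turns [y ^+ j] into a multiple of
    [basis_fn j]. *)
Lemma normal_form z : exists2 D, D != 0 &
  exists G : 'I_m -> {poly K}, evx D * z = \sum_j evx (G j) * basis_fn j.
Proof.
have [N [D [D0 ->]]] := xy_gen z.
have [F ->] := generated2_evxy N; have [F' FE] := generated2_evxy D.
rewrite FE in D0 *; have [g g0 [G gE]] := evxy_norm D0.
exists g => //.
have -> : evx g * (evxy F / evxy F') = evxy (F * G).
  by rewrite gE rmorphM; field.
have monY : 'X^m - f%:P \is monic by rewrite monicXnsubC // ltnW.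
set H := F * G; set R := Pdiv.Ring.rmodp H ('X^m - f%:P).
have szR : (size R <= m)%N.
  have := Pdiv.Ring.ltn_rmodpN0 H (monic_neq0 monY).
  by rewrite size_XnsubC ?(ltnW m_gt1).
have -> : evxy H = evxy R.
  rewrite {1}(Pdiv.RingMonic.rdivp_eq monY H) rmorphD rmorphM rmorphB rmorphXn.
  by rewrite evxyX evxyC evx_f subrr mulr0 add0r.
exists (fun j => R`_j * floor_poly j).
rewrite evxyE (@horner_coef_wide _ m) ?(leq_trans (size_poly _ _)) //=.
apply: eq_bigr => j _; rewrite coef_map.
rewrite rmorphM -mulrA /basis_fn [y ^+ j / _]mulrC mulVKf // evx_eq0.
exact: floor_poly_neq0.
Qed.

Definition prod_alpha (e : 'I_r -> nat) : {poly K} :=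
  \prod_(l < r) ('X - (alpha l)%:P) ^+ e l.

Lemma prod_alpha_monic e : prod_alpha e \is monic.
Proof. by apply: monic_prod => l _; apply: monic_exp; apply: monicXsubC. Qed.

Lemma size_prod_alpha e : size (prod_alpha e) = (\sum_l e l).+1.
Proof.
rewrite /prod_alpha; elim/big_rec2: _ => [|l n p _ sp];
  first by rewrite size_poly1.
rewrite size_monicM ?monic_exp ?monicXsubC // -?size_poly_eq0 ?sp //.
by rewrite size_exp_XsubC addSn addnS.
Qed.

Lemma mup_prod_alpha e l : mup (alpha l) (prod_alpha e) = e l.
Proof.
rewrite /prod_alpha (bigD1 l) //= mupMl ?mup_XsubCX ?eqxx //.
rewrite rootE horner_prod; apply/prodf_neq0 => l' l'l.
by rewrite horner_exp hornerXsubC expf_neq0 // subr_eq0 inj_eq // eq_sym.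
Qed.

Lemma evx_residue P h a : place i P -> place_ideal P (x - i a) ->
  place_ideal P (evx h - i h.[a]).
Proof.
move=> Pp xa; have Px : P x.
  rewrite -[x](subrK (i a)); apply: (placeD Pp); last exact: place_const.
  exact: place_ideal_sub xa.
have Ph g : P (evx g).
  rewrite evxE horner_coef; apply: (place_sum Pp) => j _; rewrite coef_map.
  by apply: (placeM Pp); [apply: place_const | apply: (placeX Pp)].
have /factor_theorem[q hq] : root (h - h.[a]%:P) a.
  by rewrite rootE hornerD hornerN hornerC subrr.
rewrite -evxC -rmorphB hq rmorphM evx_XsubC.
exact: (place_idealM Pp).
Qed.

Lemma evx_nonzero_residue P h a : place i P -> place_ideal P (x - i a) ->
  h.[a] != 0 -> nonzero_residue i P (evx h).
Proof. by move=> Pp xa ha; exists h.[a] => //; apply: evx_residue. Qed.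

Lemma evx_ord P h a : place i P -> place_ideal P (x - i a) -> h != 0 ->
  place_ord i P (x - i a) (evx h) (mup a h).
Proof.
move=> Pp xa h0; have [n [q + hq]] := multiplicity_XsubC h a.
rewrite h0 /= => qa.
have -> : mup a h = n by rewrite hq mupMr // mup_XsubCX eqxx.
rewrite hq rmorphM rmorphXn evx_XsubC -[n%:Z]add0r.
apply: (place_ordM Pp (x_sub_neq0 a)).
  by apply/place_ord0P; apply: (evx_nonzero_residue Pp xa).
by have := place_ordXn Pp (x_sub_neq0 a) n (place_ord_uniformizer Pp (x_sub_neq0 a)); rewrite mul1r.
Qed.

Lemma evx_ord_infinity P h : place i P -> ~ P x -> h != 0 ->
  place_ord i P x^-1 (evx h) (- (size h).-1%:Z).
Proof.
move=> Pp nPx h0; have [xn0 xV] := place_notin Pp nPx.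
rewrite /place_ord opprK -exprnP exprVn; exists (lead_coef h).
  by rewrite lead_coef_eq0.
have sh : size h = (size h).-1.+1 by rewrite prednK // size_poly_gt0.
rewrite evxE horner_coef size_map_poly sh big_ord_recr /= coef_map mulrDl.
rewrite mulfK ?expf_neq0 // lead_coefE addrK mulr_suml.
apply: (place_ideal_sum Pp) => j _; rewrite coef_map -mulrA.
apply: (place_idealM Pp); first exact: place_const.
set d := (size h).-1 in j *.
have -> : x ^+ j / x ^+ d = x^-1 ^+ (d - j).
  by rewrite exprVn expfB // invf_div.
by apply: (place_ideal_exp Pp) => //; rewrite subn_gt0.
Qed.

(** [P] is totally ramified over [K(x)] at a place where [h : K[x]] has
    order [o h]. *)
Definition ramified P (o : {poly K} -> int) (e : int) t : Prop :=
  [/\ place_ideal P t, t != 0, forall h, h != 0 ->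
    place_ord i P t (evx h) (o h * m%:Z)
    & place_ord i P t y e].

(** With Bezout coefficients [u e + v m = 1], the element [t = y^u t1^v] has [t^m] of order 1 for
    [t1], and [y t^(-e) = (y^m t1^(-e))^v]; so the residues needed are constants. *)
Lemma ramified_exists P t1 (o : {poly K} -> int) e : place i P ->
  place_ideal P t1 -> t1 != 0 ->
  (forall h, h != 0 -> place_ord i P t1 (evx h) (o h)) ->
  place_ord i P t1 (y ^+ m) e -> coprimez e m -> exists t, ramified P o e t.
Proof.
move=> Pp mt1 t10 oP oy /coprimezP[[u v] /= uv].
pose t := y ^ u * t1 ^ v.
have t0 : t != 0 by rewrite mulf_neq0 // expfz_neq0 // y_neq0.
have tm : place_ord i P t1 (t ^+ m) 1.
  have -> : t ^+ m = (y ^+ m) ^ u * t1 ^ (v * m%:Z).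
    rewrite /t exprMn [(y ^ u) ^+ m]exprnP [(t1 ^ v) ^+ m]exprnP [y ^+ m]exprnP.
    by rewrite !exprz_exp [u * _]mulrC.
  have <- : e * u + v * m%:Z = 1 by rewrite -uv [e * u]mulrC.
  by apply: (place_ordM Pp t10);
    [apply: place_ordXz | apply: place_ord_uniformizerX].
have mt : place_ideal P t.
  by apply: (place_ideal_root Pp (ltnW m_gt1));
    apply/(place_ord_gt0 Pp mt1 t10 tm).
have t1m : nonzero_residue i P (t1 / t ^+ m).
  apply/(@place_ord0P _ _ i P t1); rewrite -(subrr 1);
    apply: (place_ordM Pp t10).
    exact: place_ord_uniformizer.
  exact: place_ordV.
have lift z n : place_ord i P t1 z n -> place_ord i P t z (n * m%:Z).
  move=> oz; rewrite /place_ord.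
  have -> : z * t ^ (- (n * m%:Z)) = z * t1 ^ (- n) * (t1 / t ^+ m) ^ n.
    rewrite expfzMl mulrA -[z * _ * _]mulrA -expfzDr // addNr expr0z mulr1.
    rewrite exprz_inv [t ^+ m]exprnP exprz_exp; congr (_ * t ^ _).
    by rewrite mulrN mulrC.
  by apply: (nonzero_residueM Pp) => //; apply: nonzero_residueX.
exists t; split=> [||h h0|] //; first by apply: lift; apply: oP.
rewrite /place_ord.
have -> : y * t ^ (- e) = (y ^+ m * t1 ^ (- e)) ^ v.
  rewrite /t !expfzMl [y ^+ m]exprnP !exprz_exp mulrA -{1}[y]expr1z -uv.
  rewrite -expfzDr ?y_neq0 //; congr (y ^ _ * t1 ^ _); lia.
exact: (nonzero_residueX Pp).
Qed.

(** Modulo [m] only [e j] remains; for [e] prime to [m] the terms have pairwise distinct orders and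
    cannot cancel. *)
Definition term_order (o : {poly K} -> int) (e : int) (G :
  'I_m -> {poly K}) (j : 'I_m) : int :=
  o (G j) * m%:Z + (e * j%:Z - o (floor_poly j) * m%:Z).

Lemma ramified_term P o e t (G : 'I_m -> {poly K}) j :
  place i P -> ramified P o e t ->
  G j != 0 -> place_ord i P t (evx (G j) * basis_fn j) (term_order o e G j).
Proof.
move=> Pp [mt t0 oP oy] Gj; apply: (place_ordM Pp t0); first exact: oP.
apply: (place_ordM Pp t0); first exact: place_ordXn.
by apply: (place_ordV Pp); apply: oP; apply: floor_poly_neq0.
Qed.

Lemma ramified_sum P o e t (G : 'I_m -> {poly K}) :
  place i P -> ramified P o e t ->
  coprimez e m -> (exists j, G j != 0) -> exists j, [/\ G j != 0,
    place_ord i P t (\sum_j evx (G j) * basis_fn j) (term_order o e G j)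
  & forall j', G j' != 0 -> term_order o e G j <= term_order o e G j'].
Proof.
move=> Pp Pr em [j0 Gj0].
have Gw j : (evx (G j) * basis_fn j != 0) = (G j != 0).
  by rewrite mulf_eq0 negb_or basis_fn_neq0 andbT evx_eq0.
have [mt t0 _ _] := Pr.
have [j|j j'||j [Gj oj jmin]] := @place_ord_sum _ _ i P Pp t mt t0 'I_m
    (fun j => evx (G j) * basis_fn j) (term_order o e G).
- by rewrite Gw => Gj; apply: (ramified_term Pp Pr).
- rewrite !Gw => Gj Gj' /eqP eqo; apply/eqP; rewrite -val_eqE /=.
  have : (m%:Z %| (j%:Z - j'%:Z) * e)%Z.
    apply/dvdzP; exists (o (G j') - o (floor_poly j') - o (G j) + o (floor_poly j)).
    move: eqo; rewrite /term_order => eqo; apply/eqP; rewrite -subr_eq0.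
    by rewrite -subr_eq0 in eqo; apply: etrans eqo; congr (_ == 0); ring.
  rewrite Gauss_dvdzl 1?coprimez_sym // => /dvdzP[d dE].
  have jm := ltn_ord j; have jm' := ltn_ord j'; clear -dE jm jm'.
  have [d0|d0] := eqVneq d 0; first by move: dE; rewrite d0 mul0r; lia.
  by exfalso; nia.
- by exists j0; rewrite Gw.
by exists j; split=> [||j']; rewrite -?Gw //; apply: jmin.
Qed.

Lemma sum_basis_fn_neq0 D z (G : 'I_m -> {poly K}) : z != 0 -> D != 0 ->
  evx D * z = \sum_j evx (G j) * basis_fn j -> exists j, G j != 0.
Proof.
move=> z0 D0 GE; apply: contrapT => H.
suff : evx D * z == 0 by rewrite mulf_eq0 evx_eq0 (negbTE D0) (negbTE z0).
rewrite GE big1 // => j _; have [->|Gj] := eqVneq (G j) 0.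
  by rewrite rmorph0 mul0r.
by exfalso; apply: H; exists j.
Qed.

Lemma ramified_uniformizer P o e t : place i P -> ramified P o e t ->
  coprimez e m -> uniformizer i P t.
Proof.
move=> Pp Pr em z z0; have [D D0 [G GE]] := normal_form z.
have [mt t0 oP _] := Pr.
have [j [_ oj _]] := ramified_sum Pp Pr em (sum_basis_fn_neq0 z0 D0 GE).
exists (term_order o e G j - o D * m%:Z).
have -> : z = (\sum_j evx (G j) * basis_fn j) / evx D by rewrite -GE mulrC mulKf // evx_eq0.
by apply: (place_ordM Pp t0) => //; apply: (place_ordV Pp); apply: oP.
Qed.

(** The order of [z] found from its normal form involves only [o] and [e], so two places with the
    same data contain the same functions. *)
Lemma ramified_sub P P' o e t t' :
  place i P -> place i P' -> ramified P o e t ->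
  ramified P' o e t' -> coprimez e m -> P `<=` P'.
Proof.
move=> Pp Pp' Pr Pr' em z Pz.
have [->|z0] := eqVneq z 0; first exact: place0 Pp'.
have [D D0 [G GE]] := normal_form z.
have G0 := sum_basis_fn_neq0 z0 D0 GE.
have zE : z = (\sum_j evx (G j) * basis_fn j) / evx D by rewrite -GE mulrC mulKf // evx_eq0.
have [j [Gj oj jmin]] := ramified_sum Pp Pr em G0.
have [j' [Gj' oj' jmin']] := ramified_sum Pp' Pr' em G0.
have [[mt t0 oP _] [mt' t0' oP' _]] := (Pr, Pr').
have oz := place_ordM Pp t0 oj (place_ordV Pp (oP D D0)).
have oz' := place_ordM Pp' t0' oj' (place_ordV Pp' (oP' D D0)).
rewrite -zE in oz oz'; apply/(place_ord_ge0 Pp' mt' t0' oz').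
move/(place_ord_ge0 Pp mt t0 oz): Pz => /le_trans; apply; rewrite lerD2r.
exact: jmin.
Qed.

Lemma ramified_uniq P P' o e t t' :
  place i P -> place i P' -> ramified P o e t ->
  ramified P' o e t' -> coprimez e m -> P = P'.
Proof.
by move=> Pp Pp' Pr Pr' em; apply/seteqP; split; apply: ramified_sub em;
  eassumption.
Qed.

(** * Ramified places at infinity and above the [alpha l] *)

Let o_inf (h : {poly K}) : int := - (size h).-1%:Z.
Let e_inf : int := - (\sum_l lambda l)%:Z.

Lemma e_inf_coprime : coprimez e_inf m.
Proof. by rewrite coprimezE abszN. Qed.

Lemma infinity_ramified P :
  place i P -> ~ P x -> exists t, ramified P o_inf e_inf t.
Proof.
move=> Pp Px; have [x0 xV] := place_notin Pp Px.
apply: (@ramified_exists P x^-1) => //; first by rewrite invr_eq0.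
- by move=> h; apply: evx_ord_infinity.
- have := evx_ord_infinity Pp Px (monic_neq0 (prod_alpha_monic lambda)).
  by rewrite size_prod_alpha evx_f.
- exact: e_inf_coprime.
Qed.

Lemma infinity_uniq P : place i P -> ~ P x -> P = Q.
Proof.
move=> Pp Px; have [t Pr] := infinity_ramified Pp Px.
have [t' Qr] := infinity_ramified Q_place Qx.
exact: (ramified_uniq Pp Q_place Pr Qr e_inf_coprime).
Qed.

Lemma alpha_ramified P l : place i P -> place_ideal P (x - i (alpha l)) ->
  exists t, ramified P (fun h => mup (alpha l) h) (lambda l) t.
Proof.
move=> Pp xa; apply: (ramified_exists Pp xa (x_sub_neq0 _)).
- by move=> h; apply: evx_ord.
- have := evx_ord Pp xa (monic_neq0 (prod_alpha_monic lambda)).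
  by rewrite mup_prod_alpha evx_f.
- exact: lambda_coprime.
Qed.

(** A combination with a nonzero coefficient has an order at [Q], hence is not 0. This does the work
    of the irreducibility of [Y^m - f]. *)
Lemma basis_fn_free (G : 'I_m -> {poly K}) :
  \sum_j evx (G j) * basis_fn j = 0 -> forall j, G j = 0.
Proof.
move=> G0 j; apply: contrapT => /eqP Gj.
have [t Qr] := infinity_ramified Q_place Qx.
have [|j' [_ oj _]] := ramified_sum Q_place Qr e_inf_coprime (G := G);
  first by exists j.
by move: (place_ord_neq0 Q_place oj); rewrite G0 eqxx.
Qed.

(** The remainder of [F] modulo [Y^m - f] vanishes by freeness, so [F] is a multiple of
    [Y^m - f]. *)
Lemma evxy_relation F a b : evxy F = 0 -> b ^+ m = f.[a] -> F.[b%:P].[a] = 0.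
Proof.
move=> F0 ba.
have monY : 'X^m - f%:P \is monic by rewrite monicXnsubC // ltnW.
have FE := Pdiv.RingMonic.rdivp_eq monY F.
set q := Pdiv.Ring.rdivp _ _ in FE; set R := Pdiv.Ring.rmodp _ _ in FE.
have szR : (size R <= m)%N.
  have := Pdiv.Ring.ltn_rmodpN0 F (monic_neq0 monY).
  by rewrite size_XnsubC ?(ltnW m_gt1).
suff R0 : R = 0.
  rewrite FE R0 addr0 !hornerM hornerD hornerN hornerXn hornerC.
  by rewrite hornerD hornerN horner_exp hornerC ba subrr mulr0.
have evR : evxy R = 0.
  have : evxy F = evxy R.
    rewrite FE rmorphD rmorphM rmorphB rmorphXn.
    by rewrite evxyX evxyC evx_f subrr mulr0 add0r.
  by rewrite F0.
have RG : forall j : 'I_m, R`_j * floor_poly j = 0.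
  apply: (@basis_fn_free (fun j => R`_j * floor_poly j)); apply: etrans evR.
  rewrite evxyE (@horner_coef_wide _ m) ?(leq_trans (size_poly _ _)) //=.
  apply: eq_bigr => j _;
    rewrite coef_map rmorphM -mulrA /basis_fn [y ^+ j / _]mulrC mulVKf //.
  by rewrite evx_eq0 floor_poly_neq0.
apply/polyP => j; rewrite coef0; have [jm|mj] := ltnP j m.
  by apply/eqP; have /eqP := RG (Ordinal jm);
    rewrite mulf_eq0 (negbTE (floor_poly_neq0 _)) orbF.
by rewrite nth_default // (leq_trans szR).
Qed.

(** * Places over the affine points *)

Definition centered P a b : Prop :=
  [/\ place i P, place_ideal P (x - i a) & place_ideal P (y - i b)].

Lemma centered_exists a b : b ^+ m = f.[a] -> exists P, centered P a b.
Proof.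
move=> ba; have [|||P [Pp _ xa yb]] :=
    @place_extension _ _ i (x - i a) (y - i b) (range evxy).
- split.
  + by exists 1 => //; apply: rmorph1.
  + move=> _ _ [F _ <-] [G _ <-]; split.
      by exists (F - G) => //; apply: rmorphB.
    by exists (F * G) => //; apply: rmorphM.
  + by exists ('X - a%:P)%:P => //; rewrite evxyC evx_XsubC.
  + by exists ('X - b%:P%:P) => //; rewrite rmorphB evxyX evxyC evxC.
  (* An expression of 1 by [x - i a] and [y - i b] would be a relation between [x] and [y];
     evaluated at [(a, b)] it reads [-1 = 0]. *)
  + move=> _ _ [F _ <-] [G _ <-]; apply/eqP => FG1.
    pose U := ('X - a%:P)%:P * F + ('X - b%:P%:P) * G - 1.
    have /evxy_relation/(_ ba)/eqP : evxy U = 0.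
      rewrite rmorphB rmorphD !rmorphM evxyC evx_XsubC rmorphB rmorph1 evxyC evxyX evxC.
      by rewrite FG1 subrr.
    rewrite /U !hornerD !hornerN !hornerM !hornerD !hornerN !hornerE !subrr.
    by rewrite !mul0r !add0r oppr_eq0 oner_eq0.
- by move=> _ [c _ <-]; exists c%:P%:P => //; rewrite evxyC evxC.
- exact: x_sub_neq0.
by exists P.
Qed.

Lemma evxy_residue P a b F :
  centered P a b -> place_ideal P (evxy F - i F.[b%:P].[a]).
Proof.
move=> [Pp xa yb]; have Py : P y.
  rewrite -[y](subrK (i b)); apply: (placeD Pp); last exact: place_const.
  exact: place_ideal_sub yb.
have Px h : P (evx h).
  rewrite -[evx h](subrK (i h.[a])); apply: (placeD Pp);
    last exact: place_const.
  exact: place_ideal_sub (evx_residue _ Pp xa).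
have PF G : P (evxy G).
  rewrite evxyE horner_coef; apply: (place_sum Pp) => j _; rewrite coef_map.
  by apply: (placeM Pp); [apply: Px | apply: (placeX Pp)].
have /factor_theorem[q hq] : root (F - F.[b%:P]%:P) b%:P.
  by rewrite rootE hornerD hornerN hornerC subrr.
rewrite -[evxy F](subrK (evx F.[b%:P])) -addrA; apply: (place_idealD Pp);
  last exact: evx_residue.
rewrite -evxyC -rmorphB hq rmorphM rmorphB evxyX evxyC evxC.
exact: (place_idealM Pp).
Qed.

Lemma f_root a : (f.[a] == 0) = [exists l, a == alpha l].
Proof.
apply/idP/existsP => [|[l /eqP ->]].
  rewrite horner_prod => /prodf_eq0[l _];
    rewrite horner_exp hornerXsubC expf_eq0 subr_eq0.
  by case/andP => _ al; exists l.
rewrite horner_prod (bigD1 l) //= horner_exp hornerXsubC subrr expr0n.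
by rewrite eqn0Ngt lambda_gt0 mul0r.
Qed.

(** As [y - b] divides [y ^+ m - b ^+ m = f(x) - f(a)] up to a unit at [(a, b)],
    [x - a] is a local parameter there; the norm bounds the order of a zero. *)
Lemma unramified_order a b F : b ^+ m = f.[a] -> b != 0 -> evxy F != 0 ->
  exists n : int, forall P, centered P a b ->
    place_ord i P (x - i a) (evxy F) n.
Proof.
move=> ba b0 F0; have [g g0 [G gE]] := evxy_norm F0.
have [k [q + gq]] := multiplicity_XsubC g a; rewrite g0 /= => qa.
have {gE} : evxy F * evxy G = (x - i a) ^+ k * evxy q%:P.
  by rewrite -gE gq rmorphM rmorphXn evx_XsubC evxyC mulrC.
have : (q%:P).[b%:P].[a] != 0 by rewrite hornerC.
move: (q%:P : {poly {poly K}}) => U; elim: k F U {F0 gq} => [|k IH] F U Uab FG.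
  exists 0 => P Pc; apply/place_ord0P; exists F.[b%:P].[a];
    last exact: evxy_residue.
  have /evxy_relation/(_ ba)/eqP : evxy (F * G - U) = 0.
    by rewrite rmorphB rmorphM FG expr0 mul1r subrr.
  rewrite !hornerD !hornerN !hornerM subr_eq0 => /eqP UE.
  by move: Uab; rewrite -UE mulf_eq0 negb_or => /andP[].
have [Fab|Fab] := eqVneq F.[b%:P].[a] 0; last first.
  exists 0 => P Pc; apply/place_ord0P; exists F.[b%:P].[a] => //.
  exact: evxy_residue.
have t0 := x_sub_neq0 a.
(* The quotient of [Y^m - b^m] by [Y - b]; its value [m b^(m-1)] at the point is nonzero since [m]
   is invertible in [K] and [b != 0]. *)
pose S : {poly {poly K}} := \sum_(l < m) 'X^(m.-1 - l) * (b%:P%:P) ^+ l.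
have Sab : S.[b%:P].[a] != 0.
  suff -> : S.[b%:P].[a] =
    b ^+ m.-1 *+ m by rewrite -mulr_natr mulf_neq0 ?expf_neq0.
  rewrite !horner_sum; under eq_bigr => l _.
    rewrite hornerM hornerXn horner_exp hornerC -exprD subnK; last first.
      by rewrite -ltnS prednK // ltnW.
    rewrite horner_exp hornerC.
    over.
  by rewrite sumr_const card_ord.
have /factor_theorem[p pE] : root (F - F.[b%:P]%:P) b%:P.
  by rewrite rootE hornerD hornerN hornerC subrr.
have /factor_theorem[h1 hE] : root F.[b%:P] a by apply/rootP.
have /factor_theorem[f1 fE] : root (f - f.[a]%:P) a.
  by rewrite rootE hornerD hornerN hornerC subrr.
(* On the curve [F = p (y - b) + h1 (x - a)] and [S (y - b) = f1 (x - a)]. Hence [S F = (x - a) F'],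
   and one factor [x - a] cancels against the norm. *)
pose F' := p * f1%:P + S * h1%:P.
have SF : evxy S * evxy F = (x - i a) * evxy F'.
  have -> : evxy F = evxy p * (y - i b) + evx h1 * (x - i a).
    rewrite -[F in LHS](subrK F.[b%:P]%:P) pE rmorphD rmorphM rmorphB evxyX !evxyC evxC.
    by rewrite hE rmorphM evx_XsubC.
  have Syb : evxy S * (y - i b) = evx f1 * (x - i a).
    rewrite -evx_XsubC -rmorphM -fE rmorphB evx_f evxC -ba rmorphXn subrXX mulrC.
    congr (_ * _); rewrite rmorph_sum; apply: eq_bigr => l _.
    by rewrite rmorphM !rmorphXn evxyX evxyC evxC.
  rewrite mulrDr mulrCA Syb rmorphD !rmorphM !evxyC; ring.
have [||n nP] := IH F' (S * U).
- by rewrite !hornerM mulf_neq0.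
- apply: (mulfI t0); rewrite mulrA -SF -mulrA FG rmorphM exprS; ring.
exists (1 + n) => P Pc; have [Pp xa _] := Pc.
have oS : place_ord i P (x - i a) (evxy S) 0.
  by apply/place_ord0P; exists S.[b%:P].[a] => //; apply: evxy_residue.
have S0 := place_ord_neq0 Pp oS.
have -> : evxy F = (x - i a) * evxy F' * (evxy S)^-1 by rewrite -SF mulrC mulKf.
rewrite -[1 + n]subr0; apply: (place_ordM Pp t0); last exact: (place_ordV Pp).
by apply: (place_ordM Pp t0); [apply: place_ord_uniformizer | apply: nP].
Qed.

(** The order is chosen before the place: two places with the same centre then assign the same order
    to every function, which is how [centered_uniq] identifies them. *)
Lemma unramified_order_all a b z : b ^+ m = f.[a] -> b != 0 -> z != 0 ->
  exists n : int, forall P, centered P a b -> place_ord i P (x - i a) z n.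
Proof.
move=> ba b0 z0; have [N [D [D0 zE]]] := xy_gen z.
have [F FE] := generated2_evxy N; have [F' FE'] := generated2_evxy D.
rewrite FE FE' in zE; rewrite FE' in D0.
have F0 : evxy F != 0 by apply: contra_neq z0; rewrite zE => ->; rewrite mul0r.
have [n nP] := unramified_order ba b0 F0.
have [n' nP'] := unramified_order ba b0 D0.
exists (n - n') => P Pc; have [Pp xa _] := Pc; rewrite zE.
apply: (place_ordM Pp (x_sub_neq0 a)); first exact: nP.
by apply: (place_ordV Pp); apply: nP'.
Qed.

Lemma nth_roots c : exists s : seq K,
  [/\ size s = m, forall b, (b \in s) = (b ^+ m == c) & c != 0 -> uniq s].
Proof.
have monY : 'X^m - c%:P \is monic by rewrite monicXnsubC // ltnW.
have [s sE] := closed_field_poly_normal ('X^m - c%:P).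
move: sE; rewrite (eqP monY) scale1r => sE.
have sP b : (b \in s) = (b ^+ m == c).
  by rewrite -root_prod_XsubC -sE rootE hornerD hornerN hornerXn hornerC subr_eq0.
exists s; split=> // [|c0].
  by apply: succn_inj; rewrite -(size_prod_XsubC s id) -sE size_XnsubC // ltnW.
apply: count_mem_uniq => b; have [bs|/count_memPn -> //] := boolP (b \in s).
(* A multiple root would be a root of the derivative [m X^(m-1)], hence 0. *)
apply/eqP; rewrite eqn_leq -has_count has_pred1 bs andbT -mu_prod_XsubC -sE.
rewrite (mup_leq _ _ (monic_neq0 monY)); apply/negP => /dvdpP[q qE].
have /(congr1 (fun p : {poly K} => p^`().[b])) := qE.
rewrite derivB derivXn derivC subr0 hornerMn hornerXn derivM deriv_exp derivXsubC /=.
rewrite hornerD !hornerM hornerMn hornerM hornerC !horner_exp hornerXsubC subrr.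
rewrite !expr0n /= !mulr0 mul0rn mulr0 addr0 => /eqP.
rewrite -mulr_natr mulf_eq0 (negbTE m_neq0) orbF expf_eq0 => /andP[_ /eqP b0].
by move: bs c0; rewrite sP b0 expr0n eqn0Ngt (ltnW m_gt1) eq_sym => ->.
Qed.

Lemma centered_relation P a b : centered P a b -> b ^+ m = f.[a].
Proof.
move=> Pc; have [Pp _ _] := Pc; apply/eqP; rewrite -subr_eq0; apply/eqP.
apply: (place_ideal_const Pp).
have := evxy_residue ('X^m - f%:P) Pc.
rewrite rmorphB rmorphXn evxyX evxyC evx_f subrr sub0r.
rewrite !hornerD !hornerN hornerXn !hornerC horner_exp hornerC.
by move/(place_idealN Pp); rewrite opprK.
Qed.

Lemma ordinate_eq0 a b : b ^+ m = f.[a] -> (b == 0) = [exists l, a == alpha l].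
Proof. by move=> ba; rewrite -f_root -ba expf_eq0 ltnW. Qed.

Lemma place_evx_unit P h :
  place i P -> P x -> (forall a, ~ place_ideal P (x - i a)) ->
  h != 0 -> P (evx h)^-1.
Proof.
move=> Pp Px nxa h0; have [s sE] := closed_field_poly_normal h.
have Pxa a : P (x - i a) by apply: (placeB Pp) => //; apply: place_const.
rewrite sE -mul_polyC rmorphM evxC invfM.
apply: (placeM Pp); first by rewrite -fmorphV; apply: place_const.
rewrite rmorph_prod -prodfV; apply: (place_prod Pp) => a _.
by rewrite evx_XsubC; have [] := place_ideal_inv Pp (Pxa a) (nxa a).
Qed.

Lemma place_centered P : place i P -> P x -> exists a b, centered P a b.
Proof.
move=> Pp Px.
have Pevx h : P (evx h).
  rewrite evxE horner_coef; apply: (place_sum Pp) => j _; rewrite coef_map.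
  by apply: (placeM Pp); [apply: place_const | apply: (placeX Pp)].
have Py : P y by apply: (place_root Pp (ltnW m_gt1)); rewrite -evx_f.
have [[a xa]|H] := pselect (exists a, place_ideal P (x - i a)); last first.
  have nxa a : ~ place_ideal P (x - i a) by move=> xa; apply: H; exists a.
  (* If no [x - i a] were a nonunit, all nonzero polynomials in [x] would be units of [P], and the
     normal form would put all of [E] into [P]. *)
  have [_ [_ nPT] _ _] := Pp; exfalso; apply: nPT => z _.
  have [D D0 [G GE]] := normal_form z.
  have -> : z = (\sum_j evx (G j) * basis_fn j) * (evx D)^-1.
    by rewrite -GE mulrC mulKf // evx_eq0.
  apply: (placeM Pp); last exact: place_evx_unit.
  apply: (place_sum Pp) => j _; apply: (placeM Pp) => //; apply: (placeM Pp).
    exact: (placeX Pp).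
  by apply: place_evx_unit => //; apply: floor_poly_neq0.
have [s [_ sP _]] := nth_roots f.[a].
have [s' s'E] := closed_field_poly_normal ('X^m - f.[a]%:P).
have monY : 'X^m - f.[a]%:P \is monic by rewrite monicXnsubC // ltnW.
rewrite (eqP monY) scale1r in s'E.
(* The product is [y^m - f(a) = f(x) - f(a)], a nonunit; as the maximal ideal is prime, some factor
   [y - i b] is a nonunit. *)
have : place_ideal P (\prod_(b <- s') (y - i b)).
  have -> : \prod_(b <- s') (y - i b) = (map_poly i ('X^m - f.[a]%:P)).[y].
    rewrite s'E rmorph_prod horner_prod; apply: eq_bigr => b _.
    by rewrite rmorphB /= map_polyX map_polyC hornerXsubC.
  rewrite rmorphB /= map_polyXn map_polyC hornerD hornerN hornerXn hornerC -evx_f.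
  exact: evx_residue.
case/(place_ideal_prod Pp) => [b|b yb]; last by exists a, b.
by apply: (placeB Pp) => //; apply: place_const.
Qed.

Lemma centered_uniq P P' a b : centered P a b -> centered P' a b -> P = P'.
Proof.
move=> Pc Pc'; have [[Pp xa _] [Pp' xa' _]] := (Pc, Pc').
have ba := centered_relation Pc.
have [b0|b0] := eqVneq b 0.
  have /existsP[l /eqP al] :
    [exists l, a == alpha l] by rewrite -(ordinate_eq0 ba) b0.
  rewrite al in xa xa'; have [t Pr] := alpha_ramified Pp xa.
  have [t' Pr'] := alpha_ramified Pp' xa'.
  exact: (ramified_uniq Pp Pp' Pr Pr' (lambda_coprime l)).
have t0 := x_sub_neq0 a.
apply/seteqP; split=> z Pz.
  have [->|z0] := eqVneq z 0; first exact: place0 Pp'.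
  have [n nP] := unramified_order_all ba b0 z0.
  by apply/(place_ord_ge0 Pp' xa' t0 (nP _ Pc'));
    apply/(place_ord_ge0 Pp xa t0 (nP _ Pc)).
have [->|z0] := eqVneq z 0; first exact: place0 Pp.
have [n nP] := unramified_order_all ba b0 z0.
by apply/(place_ord_ge0 Pp xa t0 (nP _ Pc));
  apply/(place_ord_ge0 Pp' xa' t0 (nP _ Pc')).
Qed.

Lemma centered_point P a b a' b' :
  centered P a b -> centered P a' b' -> a = a' /\ b = b'.
Proof.
move=> [Pp xa yb] [_ xa' yb'].
have eqc z c c' : place_ideal P (z - i c) -> place_ideal P (z - i c') -> c = c'.
  move=> zc zc'; apply/eqP; rewrite -subr_eq0; apply/eqP/(place_ideal_const Pp).
  have -> : i (c - c') = (z - i c') - (z - i c) by rewrite rmorphB; ring.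
  exact: (place_idealB Pp).
by split; [apply: eqc xa xa' | apply: eqc yb yb'].
Qed.

Lemma centered_place_x P a b : centered P a b -> P x.
Proof.
move=> [Pp xa _]; rewrite -[x](subrK (i a)); apply: (placeD Pp);
  last exact: place_const.
exact: place_ideal_sub xa.
Qed.

Lemma centered_neq_Q P a b : centered P a b -> P != Q.
Proof. by move=> Pc; apply/eqP => PQ; apply: Qx; rewrite -PQ;
  apply: centered_place_x Pc. Qed.

Lemma place_finite P : place i P -> P != Q -> exists a b, centered P a b.
Proof.
move=> Pp PQ; apply: place_centered => //; apply: contrapT => nPx.
by move/eqP: PQ; apply; apply: infinity_uniq.
Qed.

Lemma places_discrete P : place i P ->
  exists t, [/\ place_ideal P t, t != 0 & uniformizer i P t].
Proof.
move=> Pp; have [Px|nPx] := pselect (P x); last first.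
  have [t Pr] := infinity_ramified Pp nPx; have [mt t0 _ _] := Pr.
  by exists t; split=> //; apply: (ramified_uniformizer Pp Pr e_inf_coprime).
have [a [b Pc]] := place_centered Pp Px; have [_ xa _] := Pc.
have ba := centered_relation Pc.
have [b0|b0] := eqVneq b 0.
  have /existsP[l /eqP al] :
    [exists l, a == alpha l] by rewrite -(ordinate_eq0 ba) b0.
  rewrite al in xa; have [t Pr] := alpha_ramified Pp xa; have [mt t0 _ _] := Pr.
  by exists t; split=> //;
    apply: (ramified_uniformizer Pp Pr (lambda_coprime l)).
exists (x - i a); split=> //; first exact: x_sub_neq0.
by move=> z z0; have [n nP] := unramified_order_all ba b0 z0; exists n;
  apply: nP.
Qed.

(** * Divisors of the functions [x - i a] *)

Lemma valuation_ge0 P z : place i P -> z != 0 -> (0 <= valuation P z <-> P z).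
Proof.
move=> Pp z0; have [t [mt t0 oz]] := valuation_ord places_discrete Pp z0.
by split=> /(place_ord_ge0 Pp mt t0 oz).
Qed.

Lemma ramified_valuation P o e t h :
  place i P -> ramified P o e t -> coprimez e m ->
  h != 0 -> valuation P (evx h) = o h * m%:Z.
Proof.
move=> Pp Pr em h0; have [mt t0 oP _] := Pr.
exact: (valuationE Pp mt t0 (ramified_uniformizer Pp Pr em) (oP h h0)).
Qed.

Lemma valuation_Q_evx h :
  h != 0 -> valuation Q (evx h) = - ((size h).-1 * m)%N%:Z.
Proof.
move=> h0; have [t Qr] := infinity_ramified Q_place Qx.
by rewrite (ramified_valuation Q_place Qr e_inf_coprime h0) mulNr PoszM.
Qed.

Lemma valuation_alpha P l h :
  place i P -> place_ideal P (x - i (alpha l)) -> h != 0 ->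
  valuation P (evx h) = (mup (alpha l) h * m)%N%:Z.
Proof.
move=> Pp xa h0; have [t Pr] := alpha_ramified Pp xa.
by rewrite (ramified_valuation Pp Pr (lambda_coprime l) h0) PoszM.
Qed.

Lemma valuation_x_sub P a b : centered P a b ->
  valuation P (x - i a) = if b == 0 then m%:Z else 1.
Proof.
move=> Pc; have [Pp xa _] := Pc; have ba := centered_relation Pc.
have [b0|b0] := eqVneq b 0.
  have /existsP[l /eqP al] :
    [exists l, a == alpha l] by rewrite -(ordinate_eq0 ba) b0.
  rewrite -evx_XsubC; rewrite al in xa *.
  by rewrite (valuation_alpha Pp xa) ?polyXsubC_eq0 // (@mup_XsubCX _ 1) eqxx mul1n.
apply: (valuationE Pp xa (x_sub_neq0 a)) (place_ord_uniformizer Pp (x_sub_neq0 a)) => z z0.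
by have [n nP] := unramified_order_all ba b0 z0; exists n; apply: nP.
Qed.

Lemma valuation_x_sub0 P a a' b :
  centered P a b -> a != a' -> valuation P (x - i a') = 0.
Proof.
move=> Pc aa'; have [Pp xa _] := Pc.
have [t [mt t0 ut]] := places_discrete Pp.
apply: (valuationE Pp mt t0 ut); apply/place_ord0P; rewrite -evx_XsubC.
by apply: (evx_nonzero_residue Pp xa); rewrite hornerXsubC subr_eq0.
Qed.

(** The zeros above [a] are one point of order [m] if [a] is some [alpha l], and [m] simple points
    otherwise; [Q] is a pole of order [m]. *)
Lemma x_sub_divisor a : is_divisor i (fun P => valuation P (x - i a)) /\
  divisor_degree i (fun P => valuation P (x - i a)) = 0.
Proof.
have [s [sz sP su]] := nth_roots f.[a].
have pt b : exists P, b ^+ m = f.[a] -> centered P a b.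
  have [/centered_exists[P Pc]|ba] := pselect (b ^+ m = f.[a]);
    first by exists P.
  by exists setT => /ba.
have [pl plP] := choice pt.
(* When [f(a) = 0], the list [s] repeats the root 0, but there is a single place above [a]. *)
pose s' := if f.[a] == 0 then [:: 0] else s.
have s'P b : (b \in s') = (b ^+ m == f.[a]).
  rewrite /s'; case: eqP => [->|_]; last exact: sP.
  by rewrite inE expf_eq0 ltnW.
have us' : uniq s' by rewrite /s'; case: eqP => // /eqP; apply: su.
have plc b : b \in s' -> centered (pl b) a b by rewrite s'P => /eqP /plP.
pose S := Q :: [seq pl b | b <- s'].
have Sp P : P \in S -> place i P.
  by rewrite inE => /orP[/eqP -> //|/mapP[b /plc[Pp _ _] ->]].
have SE P : place i P -> P \notin S -> valuation P (x - i a) = 0.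
  move=> Pp; rewrite inE negb_or => /andP[PQ PS].
  have [a' [b Pc]] := place_finite Pp PQ.
  apply: (valuation_x_sub0 Pc); apply: contraNneq PS => aa'; rewrite aa' in Pc.
  have bs : b \in s' by rewrite s'P (centered_relation Pc).
  by apply/mapP; exists b => //; apply: (centered_uniq Pc); apply: plc.
split; first exact: is_divisorP SE.
rewrite (degree_seq places_discrete _ Sp SE) /S; last first.
  rewrite /= map_inj_in_uniq ?us' ?andbT.
    by apply/mapP => -[b /plc /centered_neq_Q /eqP H QE]; apply: H.
  move=> b b' /plc c /plc c' e; rewrite e in c.
  by have [_] := centered_point c c'.
rewrite big_cons big_map -evx_XsubC valuation_Q_evx ?polyXsubC_eq0 // size_XsubC mul1n.
rewrite (eq_big_seq (fun b => if b == 0 then m%:Z else 1)); last first.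
  by move=> b bs; rewrite evx_XsubC (valuation_x_sub (plc b bs)).
rewrite /s'; case: (eqVneq f.[a] 0) => fa; first by rewrite big_seq1 eqxx addNr.
rewrite (eq_big_seq (fun=> 1)) => [|b].
  by rewrite big_const_seq count_predT sz iter_addr_0 natz addNr.
rewrite sP => /eqP bf; case: eqP => // b0.
by move: fa; rewrite -bf b0 expr0n eqn0Ngt (ltnW m_gt1) eqxx.
Qed.

Lemma place_killer P : place i P -> P != Q -> exists z,
  [/\ z != 0, 0 < valuation P z,
      forall P', place i P' -> P' != Q -> 0 <= valuation P' z,
      is_divisor i (fun P' => valuation P' z)
    & divisor_degree i (fun P' => valuation P' z) = 0].
Proof.
move=> Pp PQ; have [a [b Pc]] := place_finite Pp PQ.
have [dz degz] := x_sub_divisor a; have z0 := x_sub_neq0 a.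
exists (x - i a); split=> //.
  by rewrite (valuation_x_sub Pc); case: ifP => // _; rewrite ltz_nat ltnW.
move=> P' Pp' PQ'; apply/(valuation_ge0 Pp' z0);
  have [a' [b' Pc']] := place_finite Pp' PQ'.
by apply: (placeB Pp'); [apply: centered_place_x Pc' | apply: place_const].
Qed.

(** * Functions regular outside [Q] *)

Definition apery (j : nat) : nat := (\sum_l (j * lambda l) %% m)%N.

Lemma basis_fn_exp_evx j : basis_fn j ^+ m = evx (prod_alpha (fun l =>
  ((j * lambda l) %% m)%N)).
Proof.
rewrite basis_fn_exp rmorph_prod; apply: eq_bigr => l _.
by rewrite rmorphXn evx_XsubC.
Qed.

Lemma valuation_Q_basis_fn j : valuation Q (basis_fn j) = - (apery j)%:Z.
Proof.
have := valuationX places_discrete m Q_place (basis_fn_neq0 j).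
rewrite basis_fn_exp_evx valuation_Q_evx ?monic_neq0 ?prod_alpha_monic //.
rewrite size_prod_alpha PoszM mulrC -mulrN => /mulfI -> //.
by rewrite eqz_nat -lt0n ltnW.
Qed.

Lemma place_basis_fn P j : place i P -> P x -> P (basis_fn j).
Proof.
move=> Pp Px; apply: (place_root Pp (ltnW m_gt1)); rewrite basis_fn_exp.
apply: (place_prod Pp) => l _; apply: (placeX Pp); apply: (placeB Pp) => //.
exact: place_const.
Qed.

(** Above [alpha l], [basis_fn j] has order [(j * lambda l) %% m], less than [m], while polynomials
    in [x] have orders divisible by [m]. As [D z] has order at least [m] and the terms cannot
    cancel, each nonzero [G j] has positive order. *)
Lemma zero_at_alpha l (G : 'I_m -> {poly K}) D z : z != 0 -> D != 0 ->
  root D (alpha l) -> (forall P, place i P -> P != Q -> P z) ->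
  evx D * z = \sum_j evx (G j) * basis_fn j -> forall j, root (G j) (alpha l).
Proof.
move=> z0 D0 Da zP GE j.
have [|P Pc] := @centered_exists (alpha l) 0.
  apply/eqP; rewrite expr0n eqn0Ngt (ltnW m_gt1) eq_sym f_root.
  by apply/existsP; exists l.
have [Pp xa _] := Pc; have [t Pr] := alpha_ramified Pp xa.
have [->|Gj] := eqVneq (G j) 0; first exact: root0.
have [|j0 [Gj0 oj0 j0min]] := ramified_sum Pp Pr (lambda_coprime l) (G := G).
  by exists j.
have [mt t0 _ _] := Pr.
have ut := ramified_uniformizer Pp Pr (lambda_coprime l).
have vDz := valuationE Pp mt t0 ut oj0.
move: vDz (j0min j Gj); rewrite -GE (valuationM places_discrete Pp) ?evx_eq0 //.
rewrite (valuation_alpha Pp xa D0) => <-.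
have vz : 0 <= valuation P z.
  by apply/(valuation_ge0 Pp z0); apply: zP => //; apply: centered_neq_Q Pc.
have muD : (0 < mup (alpha l) D)%N by rewrite -XsubC_dvd // dvdp_XsubCl.
rewrite /term_order mup_prod_alpha -dvdp_XsubCl XsubC_dvd // => le.
rewrite lt0n; apply: contraTN (ltn_pmod (j * lambda l) (ltnW m_gt1)) => /eqP mG.
rewrite -leqNgt; move: le;
  rewrite mG mul0r add0r -PoszM [(lambda l * j)%N]mulnC.
rewrite {1}(divn_eq (j * lambda l) m) PoszD PoszM addrAC subrr add0r -lez_nat.
apply: le_trans; apply: le_trans (_ : (mup (alpha l) D * m)%N%:Z <= _).
  by rewrite lez_nat leq_pmull.
by rewrite lerDl.
Qed.

(** At each of the [m] points above [a] the sum vanishes, which makes the ordinate a root of [g]; a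
    polynomial of degree less than [m] with [m] distinct roots is 0. *)
Lemma zero_at_unramified a (G : 'I_m -> {poly K}) D z : f.[a] != 0 ->
  root D a -> (forall P, place i P -> P != Q -> P z) ->
  evx D * z = \sum_j evx (G j) * basis_fn j -> forall j, root (G j) a.
Proof.
move=> fa Da zP GE.
have fl j : (floor_poly j).[a] != 0.
  rewrite horner_prod; apply/prodf_neq0 => l _; rewrite horner_exp hornerXsubC.
  rewrite expf_neq0 // subr_eq0; move: fa;
    rewrite f_root negb_exists => /forallP.
  by apply.
pose g : {poly K} := \poly_(j < m) (if insub j is Some l then (G l).[a] / (floor_poly l).[a] else 0).
have [s [sz sP su]] := nth_roots f.[a].
have gP : all (root g) s.
  apply/allP => b; rewrite sP => /eqP ba; have [P Pc] := centered_exists ba.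
  have [Pp xa yb] := Pc; apply/rootP; apply: (place_ideal_const Pp).
  have -> : i g.[b] = evx D * z -
      \sum_(j < m) (evx (G j) * basis_fn j - i ((G j).[a] * (b ^+ j * (floor_poly j).[a]^-1))).
    rewrite GE sumrB opprB addrC subrK horner_poly rmorph_sum.
    apply: eq_bigr => j _; rewrite (_ : insub _ = Some j); last exact: valK.
    by rewrite [b ^+ j * _]mulrC mulrA.
  apply: (place_idealB Pp).
    rewrite mulrC; apply: (place_idealM Pp); first by apply: zP => //;
      apply: centered_neq_Q Pc.
    by have := evx_residue D Pp xa; rewrite (rootP Da) rmorph0 subr0.
  apply: (place_ideal_sum Pp) => j _; apply: (residueM Pp);
    first exact: evx_residue.
  apply: (residueM Pp);
    last by case: (residueV Pp (fl j) (evx_residue _ Pp xa)).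
  have := evxy_residue 'X^j Pc; rewrite rmorphXn evxyX hornerXn.
  by rewrite horner_exp hornerC.
have g0 : g = 0.
  apply: contrapT => /eqP g0; have := max_poly_roots g0 gP (su fa).
  by rewrite sz ltnNge size_poly.
move=> j; have := congr1 (fun p : {poly K} => p`_j) g0.
rewrite coef0 coef_poly ltn_ord (_ : insub _ = Some j); last exact: valK.
by move/eqP; rewrite mulf_eq0 invr_eq0 (negbTE (fl j)) orbF.
Qed.

(** Every root of the denominator is a root of all coefficients, so its linear factors can be
    cancelled one by one until [D] is constant. *)
Lemma regular_form z : z != 0 -> (forall P, place i P -> P != Q -> P z) ->
  exists G : 'I_m -> {poly K}, z = \sum_j evx (G j) * basis_fn j.
Proof.
move=> z0 zP; have [D D0 [G GE]] := normal_form z.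
have [n le_D] := ubnP (size D);
  elim: n D G D0 le_D GE => // n IH D G D0 le_D GE.
have [/eqP/size_poly1P[c c0 Dc]|sD] := eqVneq (size D) 1%N.
  exists (fun j => c^-1 *: G j); apply: (mulfI (x := evx D)).
    by rewrite evx_eq0.
  rewrite GE mulr_sumr; apply: eq_bigr => j _.
  by rewrite -mul_polyC rmorphM Dc !evxC fmorphV !mulrA mulfV ?mul1r // fmorph_eq0.
have [a Da] := closed_rootP D sD.
have GDa : forall j, root (G j) a.
  have [fa|fa] := eqVneq f.[a] 0; last exact: zero_at_unramified fa Da zP GE.
  have /existsP[l /eqP al] : [exists l, a == alpha l] by rewrite -f_root fa.
  rewrite al in Da *; exact: zero_at_alpha z0 D0 Da zP GE.
have /choice[G1 G1E] j :
  exists p, G j = p * ('X - a%:P) by apply/factor_theorem.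
have /factor_theorem[D1 D1E] := Da.
have D10 : D1 != 0 by apply: contra_neq D0; rewrite D1E => ->; rewrite mul0r.
apply: (IH D1 G1) => //.
  by move: le_D; rewrite D1E size_Mmonic ?monicXsubC // size_XsubC addn2.
apply: (mulfI (x_sub_neq0 a));
  rewrite mulrA -evx_XsubC -rmorphM mulrC [_ * D1]mulrC.
rewrite -D1E mulrC GE mulr_sumr; apply: eq_bigr => j _.
by rewrite G1E rmorphM -mulrA mulrCA.
Qed.

(** The numbers [apery j] are the Apery set of this semigroup with respect to [m]: the least
    elements of the residue classes. *)
Definition pole_numbers : set nat :=
  [set s | exists (j : 'I_m) (d : nat), s = (apery j + d * m)%N].

Lemma regular_pole z : z != 0 ->
  (forall P, place i P -> P != Q -> 0 <= valuation P z) ->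
  exists2 s, pole_numbers s & valuation Q z = - s%:Z.
Proof.
move=> z0 zP; have [|G GE] := @regular_form z z0.
  by move=> P Pp PQ; apply/(valuation_ge0 Pp z0); apply: zP.
have [t Qr] := infinity_ramified Q_place Qx; have [mt t0 _ _] := Qr.
have ut := ramified_uniformizer Q_place Qr e_inf_coprime.
have [|j [Gj oj _]] := ramified_sum Q_place Qr e_inf_coprime (G := G).
  apply: (sum_basis_fn_neq0 z0 (oner_neq0 {poly K})).
  by rewrite rmorph1 mul1r.
exists (apery j + (size (G j)).-1 * m)%N; first by exists j, (size (G j)).-1.
rewrite GE (valuationE Q_place mt t0 ut oj).
rewrite -(valuationE Q_place mt t0 ut (ramified_term Q_place Qr Gj)).
rewrite (valuationM places_discrete Q_place) ?basis_fn_neq0 ?evx_eq0 //.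
by rewrite valuation_Q_basis_fn valuation_Q_evx // -opprD PoszD addrC.
Qed.

Lemma pole_regular s : pole_numbers s -> exists z, [/\ z != 0,
  valuation Q z = - s%:Z & forall P, place i P -> P != Q -> 0 <= valuation P z].
Proof.
move=> [j [d ->]].
have z0 : evx ('X^d) * basis_fn j != 0.
  by rewrite mulf_neq0 ?basis_fn_neq0 // evx_eq0 monic_neq0 // monicXn.
exists (evx ('X^d) * basis_fn j); split=> //.
  rewrite (valuationM places_discrete Q_place) ?basis_fn_neq0 ?evx_eq0 ?monic_neq0 ?monicXn //.
  rewrite valuation_Q_basis_fn valuation_Q_evx ?monic_neq0 ?monicXn // size_polyXn.
  by rewrite -opprD PoszD addrC.
move=> P Pp PQ; apply/(valuation_ge0 Pp z0);
  have [a [b Pc]] := place_finite Pp PQ.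
have Px := centered_place_x Pc; apply: (placeM Pp); last exact: place_basis_fn.
by rewrite rmorphXn evxX; apply: (placeX Pp).
Qed.

Lemma kummer_semigroup : weierstrass_semigroup i Q = pole_numbers.
Proof. exact: (weierstrass_semigroupE Q_place regular_pole pole_regular). Qed.

Lemma kummer_genus g :
  (forall N, exists2 n,
    (N <= n)%N & (\sum_(s < n) `[< pole_numbers s >] + g = n)%N) ->
  genus i = g.
Proof.
exact: (genusE places_discrete Q_place place_killer regular_pole pole_regular).
Qed.

End Kummer.

(** * The numerical semigroup *)

Section ModularReindexing.
Local Open Scope nat_scope.
Variables (m c : nat).
Hypotheses (m_gt1 : 1 < m) (c_coprime : coprime c m).

Lemma coprime_muln_inj j j' :
  j < m -> j' < m -> j * c = j' * c %[mod m] -> j = j'.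
Proof.
wlog jj' : j j' / j' <= j.
  move=> H jm j'm e; case: (leqP j' j) => [|/ltnW] le; first exact: H.
  by apply/esym/H.
move=> jm _ /eqP; rewrite eqn_mod_dvd ?leq_mul2r ?jj' ?orbT // -mulnBl.
rewrite Gauss_dvdl 1?coprime_sym // => /dvdn_leq dv.
apply/eqP; rewrite eqn_leq jj' andbT -subn_eq0; case: posnP => // /dv le.
by move: (leq_ltn_trans le (leq_ltn_trans (leq_subr _ _) jm)); rewrite ltnn.
Qed.

Let h (j : 'I_m) : 'I_m := Ordinal (ltn_pmod (j * c) (ltnW m_gt1)).

Let h_inj : injective h.
Proof.
by move=> j j' /(congr1 val) /= e; apply: val_inj; apply: coprime_muln_inj e.
Qed.

Lemma coprime_muln_surj s : s < m -> exists j : 'I_m, (j * c) %% m = s.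
Proof.
move=> sm; exists (invF h_inj (Ordinal sm)).
exact: (congr1 val (f_invF h_inj (Ordinal sm))).
Qed.

Lemma sum_coprime_muln (F : nat -> nat) :
  \sum_(j < m) F ((j * c) %% m) = \sum_(j < m) F j.
Proof. by rewrite [RHS](reindex_inj h_inj). Qed.

End ModularReindexing.

(** * Gaps, Frobenius number and multiplicity *)

Section Semigroup.
Local Open Scope nat_scope.
Variables (m r : nat) (lambda : 'I_r -> nat).
Hypotheses (m_gt1 : 1 < m) (lambda_coprime : forall l, coprime (lambda l) m).
Hypothesis lambda0_coprime : coprime (\sum_l lambda l) m.
Local Notation b := (apery m lambda).
Local Notation H := (pole_numbers m lambda).
Let m_gt0 : 0 < m := ltnW m_gt1.

Lemma apery_mod j : b j %% m = (j * \sum_l lambda l) %% m.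
Proof. by rewrite modn_summ big_distrr. Qed.

Lemma pole_numbersP s (j : 'I_m) : b j = s %[mod m] -> H s <-> b j <= s.
Proof.
move=> bs; split=> [[j' [d sE]]|le].
  suff -> : j = j' by rewrite sE leq_addr.
  apply: val_inj; apply: (coprime_muln_inj lambda0_coprime (ltn_ord j) (ltn_ord j')).
  by rewrite -!apery_mod bs sE addnC modnMDl.
exists j, ((s - b j) %/ m); rewrite divnK ?subnKC //.
by rewrite -eqn_mod_dvd // bs.
Qed.

Lemma apery_surj s : exists j : 'I_m, b j = s %[mod m].
Proof.
have [j jE] := coprime_muln_surj m_gt1 lambda0_coprime (ltn_pmod s m_gt0).
by exists j; rewrite apery_mod.
Qed.

(** By [pole_numbersP] the gaps congruent to [b j] are the smaller numbers of its class, and there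
    are [b j %/ m] of them. *)
Definition gap_number := \sum_(j < m) b j %/ m.

Lemma sum_pole_numbers M :
  \sum_(s < M * m) `[< H s >] = \sum_(j < m) (M - b j %/ m).
Proof.
elim: M => [|M IH]; first by rewrite mul0n big_ord0 big1.
rewrite mulSnr big_split_ord /= IH.
(* In the block of [m] numbers from [M * m] on, the class of [b j] has one member, which lies in [H]
   iff [b j %/ m] is at most [M]. *)
have -> : \sum_(s < m) `[< H (M * m + s) >] = \sum_(j < m) (b j %/ m <= M).
  rewrite -(sum_coprime_muln m_gt1 lambda0_coprime (fun s =>
    `[< H (M * m + s) >] : nat)).
  apply: eq_bigr => j _; rewrite -apery_mod; congr nat_of_bool.
  have Hj : H (M * m + b j %% m) <-> b j <= M * m + b j %% m.
    by apply: pole_numbersP; rewrite modnMDl modn_mod.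
  apply/asboolP/idP => [/Hj|le].
    by rewrite {1}(divn_eq (b j) m) leq_add2r leq_pmul2r.
  by apply/Hj; rewrite {1}(divn_eq (b j) m) leq_add2r leq_pmul2r.
rewrite -big_split /=; apply: eq_bigr => j _.
by case: leqP => [le|lt]; [rewrite addn1 subSn | lia].
Qed.

Lemma gap_count N : exists2 n,
  N <= n & \sum_(s < n) `[< H s >] + gap_number = n.
Proof.
(* The summand [gap_number] bounds every [b j %/ m], so that no subtraction in [sum_pole_numbers] is
   truncated; [N] makes [n] large. *)
set M := N + gap_number.
have le (j : 'I_m) : b j %/ m <= M.
  by rewrite (leq_trans _ (leq_addl N _)) // /gap_number (bigD1 j) //= leq_addr.
exists (M * m); first by rewrite (leq_trans (leq_addr gap_number N)) // leq_pmulr.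
rewrite sum_pole_numbers /gap_number -big_split /=.
rewrite (eq_bigr (fun=> M)) => [|j _]; last by rewrite subnK.
by rewrite sum_nat_const card_ord mulnC.
Qed.

Lemma double_sum_ord : (\sum_(j < m) j).*2 = m * m.-1.
Proof.
elim: m => [|n IH]; first by rewrite big_ord0.
by rewrite big_ord_recr /= doubleD IH; case: n {IH} => // n; rewrite -!muln2;
  lia.
Qed.

(** The sum of the [b j] is found twice. Each [lambda l] permutes the residues, which gives [r * T];
    so does the sum of the [lambda l], and dividing each [b j] by [m] gives [gap_number * m + T]. *)
Lemma double_gap_number : 0 < r -> gap_number.*2 = (m - 1) * (r - 1).
Proof.
move=> r_gt0; set T := \sum_(j < m) j.
have sb : \sum_(j < m) b j = r * T.
  rewrite exchange_big /= -[r in RHS]card_ord -sum_nat_const;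
    apply: eq_bigr => l _.
  exact: (sum_coprime_muln m_gt1 (lambda_coprime l) id).
have sb' : \sum_(j < m) b j = gap_number * m + T.
  rewrite /gap_number big_distrl /= /T -(sum_coprime_muln m_gt1 lambda0_coprime (fun j => j)).
  rewrite -big_split; apply: eq_bigr => j _ /=.
  by rewrite -apery_mod -divn_eq.
apply/eqP; rewrite -(eqn_pmul2r m_gt0); have := double_sum_ord; rewrite -/T.
move: sb'; rewrite sb; case: r r_gt0 => // r' _;
  rewrite !subn1 /= -!muln2 => e e'.
by apply/eqP; nia.
Qed.

Lemma apery_le j : b j <= r * m.-1.
Proof.
rewrite -[r in X in _ <= X]card_ord -sum_nat_const; apply: leq_sum => l _.
by rewrite -ltnS prednK // ltn_pmod.
Qed.

Lemma apery_ge (j : 'I_m) : 0 < val j -> r <= b j.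
Proof.
move=> j0; rewrite -[r in X in X <= _]card_ord -sum1_card;
  apply: leq_sum => l _.
rewrite lt0n; apply/negP; rewrite -/(dvdn _ _) Gauss_dvdl 1?coprime_sym //.
by move/(dvdn_leq j0); rewrite leqNgt ltn_ord.
Qed.

Lemma apery0 : b 0 = 0.
Proof. by rewrite /apery big1 // => l _; rewrite mod0n. Qed.

Definition all_equal := forall l l', lambda l = lambda l'.

Hypothesis lambda_lt : forall l, lambda l < m.

(** Since [v] is prime to [m], so is [j]; it can be cancelled from the congruences, and the bounds
    on [lambda] turn congruence into equality. *)
Lemma all_equal_mod j v :
  coprime v m -> (forall l, (j * lambda l) %% m = v) -> all_equal.
Proof.
move=> vm jv l l'; have jm : coprime j m.
  by move: vm; rewrite -(jv l) coprime_modl coprimeMl => /andP[].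
by apply: (coprime_muln_inj jm) => //; rewrite ![_ * j]mulnC !jv.
Qed.

Lemma all_equal_apery v : 0 < r -> v < m -> all_equal -> exists j :
  'I_m, b j = r * v.
Proof.
move=> r_gt0 vm eq; have l0 : 'I_r := Ordinal r_gt0.
have [j jE] := coprime_muln_surj m_gt1 (lambda_coprime l0) vm.
exists j; rewrite -[r in RHS]card_ord -sum_nat_const; apply: eq_bigr => l _.
by rewrite (eq l l0).
Qed.

Hypotheses (r_gt1 : 1 < r) (r_lt_m : r < m).
Let r_gt0 : 0 < r := ltnW r_gt1.

(** A gap lies at least [m] below the Apery element of its class, and
    [r (m - 1) - m = (m - 1) (r - 1) - 1]. *)
Lemma gap_number_max j n : b j = n %[mod m] -> n < b j -> n <= gap_number.*2.-1.
Proof.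
move=> bn lt; have := apery_le j; rewrite (double_gap_number r_gt0).
have /dvdnP[d dE] : m %| b j - n by rewrite -eqn_mod_dvd ?bn // ltnW.
have d0 : 0 < d by rewrite lt0n; apply/eqP => d0; move: dE; rewrite d0; lia.
have : m <= b j - n by rewrite dE leq_pmull.
by nia.
Qed.

Lemma frobenius_symmetric :
  frobenius_number H = (gap_number%:Z *+ 2 - 1)%R <-> all_equal.
Proof.
have gE := double_gap_number r_gt0.
have g0 : 0 < gap_number.*2 by rewrite gE muln_gt0; lia.
have gZ : (gap_number%:Z *+ 2 - 1)%R =
  gap_number.*2.-1%:Z :> int by rewrite -muln2; lia.
rewrite gZ; split.
  (* The default [-1] is excluded, the other side being a natural number. *)
  rewrite /frobenius_number; case: xgetP => [f ->|_]; last by [].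
  move=> [n [-> nH _]] [nE]; rewrite nE in nH.
  have [j jE] := apery_surj gap_number.*2.-1.
  have lt : gap_number.*2.-1 < b j.
    by rewrite ltnNge; apply/negP => le; apply: nH; apply/(pole_numbersP jE).
  have /dvdnP[d dE] : m %| b j - gap_number.*2.-1.
    by rewrite -eqn_mod_dvd ?jE // ltnW.
  have d0 : 0 < d by rewrite lt0n; apply/eqP => d0; move: dE; rewrite d0; lia.
  have : m <= b j - gap_number.*2.-1 by rewrite dE leq_pmull.
  (* With [g] the number of gaps, [b j] is at least [2 g - 1 + m], which is its upper bound
     [r (m - 1)]; so each of the [r] remainders is [m - 1]. *)
  move=> le; have bj : b j = r * m.-1.
    by apply/eqP; rewrite eqn_leq apery_le /=; move: le lt; rewrite gE; nia.
  apply: (@all_equal_mod j m.-1) => [|l].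
    by rewrite -[X in coprime _ X](prednK m_gt0) coprimenS.
  have le1 l' : (j * lambda l') %% m <= m.-1 by rewrite -ltnS prednK // ltn_pmod.
  apply/eqP; rewrite eqn_leq le1 /= leqNgt; apply/negP => lt1.
  suff : b j < r * m.-1 by rewrite bj ltnn.
  rewrite -[r in X in _ < X]card_ord -sum_nat_const /apery (bigD1 l) //= [X in _ < X](bigD1 l) //=.
  by rewrite -addSn leq_add // leq_sum.
move=> eq; have [|j jE] := @all_equal_apery m.-1 r_gt0 _ eq;
  first by rewrite prednK.
(* The Apery element whose remainders are all [m - 1] exceeds [2 g - 1] by exactly [m], which makes
   [2 g - 1] a gap. *)
have jg : b j = gap_number.*2.-1 + m by rewrite jE gE; nia.
have nH : ~ H gap_number.*2.-1.
  move=> /(@pole_numbersP _ j); rewrite jg modnDr => /(_ erefl); lia.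
have gmax n : ~ H n -> n <= gap_number.*2.-1.
  move=> nHn; have [j' jE'] := apery_surj n; apply: (gap_number_max jE').
  by rewrite ltnNge; apply/negP => le; apply: nHn; apply/(pole_numbersP jE').
apply: xget_unique; first by exists gap_number.*2.-1.
move=> _ [n [-> nHn nmax]]; congr Posz; apply/eqP.
by rewrite eqn_leq gmax // nmax.
Qed.

Lemma multiplicity_all_equal : multiplicity H = r <-> all_equal.
Proof.
split.
  rewrite /multiplicity; case: xgetP => [s -> [Hs s0 _] sr|_ r0]; last first.
    by move: r_gt0; rewrite -r0.
  rewrite sr in Hs; have [j [d rE]] := Hs.
  (* As [r < m], no multiple of [m] is involved and [r] is itself some [b j] with [j > 0]; [r]
     positive remainders with sum [r] are all 1. *)
  have d0 : d = 0 by case: d rE => // d; move: r_lt_m; nia.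
  rewrite d0 addn0 in rE.
  have j0 : 0 < val j.
    by rewrite lt0n; apply/eqP => j0; move: rE r_gt0; rewrite j0 apery0 => ->.
  have ge1 l : 0 < (j * lambda l) %% m.
    rewrite lt0n; apply/negP; rewrite -/(dvdn _ _) Gauss_dvdl 1?coprime_sym //.
    by move/(dvdn_leq j0); rewrite leqNgt ltn_ord.
  apply: (@all_equal_mod j 1) => [|l]; first exact: coprime1n.
  apply/eqP; rewrite eqn_leq ge1 andbT leqNgt; apply/negP => lt1.
  suff : r < b j by rewrite -rE ltnn.
  rewrite -[r in X in X < _]card_ord -sum1_card /apery (bigD1 l) //= [X in _ < X](bigD1 l) //=.
  by rewrite -addSn leq_add // leq_sum.
move=> eq; have [j jE] := all_equal_apery r_gt0 m_gt1 eq; rewrite muln1 in jE.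
have Hr : H r by exists j, 0; rewrite jE addn0.
have rmin s : H s -> s != 0 -> r <= s.
  move=> [j' [d ->]] s0; have [j0|j0] := posnP (val j').
    move: s0; rewrite j0 apery0 add0n; case: d => // d _.
    by rewrite mulSn (leq_trans (ltnW r_lt_m)) // leq_addr.
  by rewrite (leq_trans (apery_ge j0)) // leq_addr.
apply: xget_unique; first by split=> //; rewrite -lt0n.
move=> s [Hs s0 smin]; apply/eqP; rewrite eqn_leq rmin // andbT.
by apply: smin => //; rewrite -lt0n.
Qed.

End Semigroup.

(** A negative value is not the default of [xget], so it comes from a prime element [t]; if [z] were
    in [P], the unit [u = z t^(n+1)] would be a nonunit. This gives [~ Q x] before [Q] is known to
    be discrete. *)
Lemma negative_valuation_notin (k E : fieldType) (i :
  {rmorphism k -> E}) (P : set E) z :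
  place i P -> valuation P z < 0 -> ~ P z.
Proof.
move=> Pp; rewrite /valuation; case: xgetP => [n _ [t [u [tP uU zE]]]|_];
  last by rewrite ltxx.
move=> n0 Pz; case: n n0 zE => n n0 zE; first by exfalso; lia.
have mt : place_ideal P t.
  by rewrite tP; exists 1; [exact: place1 Pp | rewrite mulr1].
have [Pu u0 PuV] := uU.
have t0 : t != 0.
  apply/eqP => t0; have [_ [_ PT] _ _] := Pp; apply: PT => v _.
  apply: contrapT => /(place_notin Pp)[v0]; rewrite tP => -[w _ tw].
  by move/eqP: tw; rewrite t0 mul0r eq_sym invr_eq0 (negbTE v0).
have uE : u = z * t ^+ n.+1.
  by rewrite zE NegzE -exprz_inv -exprnP exprVn mulrAC mulVf ?mul1r // expf_neq0.
have : place_ideal P u.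
  by rewrite uE; apply: (place_idealM Pp) => //; apply: (place_ideal_exp Pp).
by case/(place_idealE Pp) => // /eqP; rewrite (negbTE u0).
Qed.

(** * Equivalence of the five statements *)

Theorem theorem5p3
  (* q is a power of the prime p, and K an algebraic closure of F_q and F_(q^2) *)
  (p q : nat) (p_prime : prime p) (q_pow : exists2 e : nat, (0 < e)%N & q = (p ^ e)%N)
  (Fq Fq2 : finFieldType) (card_Fq : #|Fq| = q) (card_Fq2 : #|Fq2| = (q ^ 2)%N)
  (K : closedFieldType) (j1 : {rmorphism Fq -> K}) (j2 : {rmorphism Fq2 -> K})
  (K_alg : integralRange j1)
  (m r : nat) (m_ge2 : (2 <= m)%N) (r_ge2 : (2 <= r)%N) (p_m : ~~ (p %| m)%N)
  (alpha : 'I_r -> K) (alpha_inj : injective alpha)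
  (lambda : 'I_r -> nat) (lambda_bound : forall l, (1 <= lambda l < m)%N)
  (lambda0_coprime : gcdn m (\sum_(l < r) lambda l)%N = 1%N)
  (* the function field E = K(x, y) of the curve *)
  (E : fieldType) (i : {rmorphism K -> E}) (x y : E)
  (x_transc : ~ algebraicOver i x)
  (xy_eq : y ^+ m = \prod_(l < r) (x - i (alpha l)) ^+ lambda l)
  (xy_gen : generated2 i x y)
  (* the place at infinity *)
  (Q : set E) (Q_place : place i Q) (Q_pole_x : valuation Q x < 0)
  (* the curve is defined over F_(q^2) *)
  (def_Fq2 : exists h : {poly Fq2},
     map_poly j2 h = \prod_(l < r) ('X - (alpha l)%:P) ^+ lambda l)
  (* the function field F_(q^2)(x, y), as a subfield of E *)
  (E0 : fieldType) (i0 : {rmorphism Fq2 -> E0}) (e : {rmorphism E0 -> E})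
  (e_const : forall c : Fq2, e (i0 c) = i (j2 c))
  (x0 y0 : E0) (e_x : e x0 = x) (e_y : e y0 = y) (xy0_gen : generated2 i0 x0 y0)
  (lambda_coprime : forall l, gcdn m (lambda l) = 1%N)
  (r_lt_m : (r < m)%N) :
  [<-> (* (i) *) castle_curve i0 i (q ^ 2) Q /\ maximal_curve i0 i q;
       (* (ii) *) castle_curve i0 i (q ^ 2) Q /\ m = (q + 1)%N;
       (* (iii) *) [/\ maximal_curve i0 i q, symmetric_at i Q & m = (q + 1)%N];
       (* (iv) *) [/\ maximal_curve i0 i q, castle_count i0 i (q ^ 2) Q
                    & m = (q + 1)%N];
       (* (v) *) [/\ maximal_curve i0 i q,
                     forall l l', lambda l = lambda l'
                   & m = (q + 1)%N]].
Proof.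
have Qx : ~ Q x by exact: (negative_valuation_notin Q_place Q_pole_x).
have m_neq0 : m%:R != 0 :> K.
  have [d _ qE] := q_pow; rewrite qE in card_Fq.
  have := finfield.card_finPcharP card_Fq p_prime.
  by rewrite -(fmorph_pchar j1) => /dvdn_pcharf <-.
have lambda_gt0 l : (0 < lambda l)%N by case/andP: (lambda_bound l).
have lambda_lt l : (lambda l < m)%N by case/andP: (lambda_bound l).
have lambda_cop l : coprime (lambda l) m by rewrite coprime_sym /coprime lambda_coprime.
have lambda0_cop : coprime (\sum_l lambda l)%N m by rewrite coprime_sym /coprime lambda0_coprime.
have HE := kummer_semigroup m_ge2 m_neq0 alpha_inj lambda_cop lambda_gt0 lambda0_cop
  x_transc xy_eq xy_gen Q_place Qx.
have gE : genus i = gap_number m lambda.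
  exact: (kummer_genus m_ge2 m_neq0 alpha_inj lambda_cop lambda_gt0 lambda0_cop
    x_transc xy_eq xy_gen Q_place Qx (gap_count m_ge2 lambda0_cop)).
have q_gt0 : (0 < q)%N.
  by have [d _ ->] := q_pow; rewrite expn_gt0 prime_gt0.
have g2 : (genus i * 2 = (m - 1) * (r - 1))%N.
  by rewrite gE muln2; apply: double_gap_number => //; apply: ltnW.
have symP : symmetric_at i Q <-> all_equal lambda.
  by rewrite /symmetric_at HE gE; apply: frobenius_symmetric.
have multP : multiplicity (weierstrass_semigroup i Q) = r <-> all_equal lambda.
  by rewrite HE; apply: multiplicity_all_equal.
rewrite /castle_curve /castle_count /maximal_curve.
set N := rational_places i0; set mu := multiplicity _ in multP *.
(* Two counts of the same set of places become an equation between natural numbers. *)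
have countP a b : (N #= `I_a)%card -> ((N #= `I_b)%card <-> a = b).
  move=> Na; split=> [Nb|<- //]; apply/card_eq_II.
  by apply: card_eq_trans Nb; rewrite card_eq_sym.
tfae.
(* With multiplicity [r] the two counts give [q^2 r = q^2 + (m - 1) (r - 1) q]; cancelling
   [q (r - 1)] leaves [q = m - 1]. *)
- move=> [[sym Nc] Nm]; split=> //; move/symP: sym => /multP mur.
  have /(_ _ Nm) := (countP _ _ Nc).1; rewrite mur; move: g2 r_ge2 m_ge2 q_gt0.
  clear; move: (genus i) => g; nia.
- move=> [[sym Nc] mq]; split=> //; have /symP/multP mur := sym.
  apply/(countP _ _ Nc); rewrite mur; move: g2 r_ge2; rewrite mq.
  clear; move: (genus i) => g; nia.
- move=> [Nm sym mq]; split=> //; have /symP/multP mur := sym.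
  apply/(countP _ _ Nm); rewrite mur; move: g2 r_ge2; rewrite mq.
  clear; move: (genus i) => g; nia.
(* Here [m - 1 = q] turns the maximal count into [q^2 r + 1], so the multiplicity is [r]. *)
- move=> [Nm Nc mq]; split=> //; apply/multP.
  have /(_ _ Nc) := (countP _ _ Nm).1; move: g2 r_ge2 q_gt0; rewrite mq.
  clear; move: (genus i) => g; nia.
- move=> [Nm eq mq]; have mur : mu = r by apply/multP.
  split=> //; split; first exact/symP.
  apply/(countP _ _ Nm); rewrite mur; move: g2 r_ge2; rewrite mq.
  clear; move: (genus i) => g; nia.
Qed.
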